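(* Let $r\in(1,3/2]$, $M\in\{t_1(r),t_2(r),t_3(r)\}$, and $\alpha\in(0,1)$. Let $\mathcal{Y}_m\subset\mathbb{R}^2$ be a fixed set of $m>3$ points in general position, no more than three cocircular, with $J_m$ Delaunay triangles. Let $S_{n,m}=\sqrt{J_m}\,(\overline{G}(r,M)-\mu)/\sigma$, where $\overline{G}(r,M)$ is the mean domination number per triangle of the proportional-edge proximity catch digraph, $\mu=3-p_r$ and $\sigma^2=p_r(1-p_r)$; let $z_\alpha=\Phi^{-1}(\alpha)$ with $\Phi$ the standard normal distribution function. For a given alternative ($H^S_\varepsilon$ or $H^A_\varepsilon$) define $$J^*(\alpha,\varepsilon)=\left\lceil\left(\frac{\sigma\, z_\alpha}{\overline{G}(r,M)-\mu}\right)^2\right\rceil,$$ where $\lceil\cdot\rceil$ is the ceiling function and $\overline{G}(r,M)$ in this formula stands for its constant limiting value as $n\to\infty$ under that alternative (this is how $J^*$ depends on $\varepsilon$). Then, as $n\to\infty$ with $m$ fixed: (i) the test against $H^S_\varepsilon$ which rejects when $S_{n,m}<z_\alpha$ is consistent for all $\varepsilon\in(0,\sqrt3/3)$ and $J_m\ge J^*(\alpha,\varepsilon)$; (ii) the test against $H^A_\varepsilon$ which rejects when $S_{n,m}>z_{1-\alpha}$ is consistent for all $\varepsilon\in(0,\sqrt3/3)$ and $J_m\ge J^*(1-\alpha,\varepsilon)$. Here consistent means that the probability of rejection under the alternative tends to $1$ as $n\to\infty$.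
   Context: Proportional-edge proximity region in one triangle. Let $T$ be a (closed) triangle with non-collinear vertices $y_1,y_2,y_3$, let $e_i$ be the edge opposite $y_i$, and let $M$ be a point in the interior of $T$. The line through $y_i$ and $M$ meets $e_i$ at a point $M_i$; the three segments $[M,M_i]$ divide $T$ into three closed regions, and the $M$-vertex region $R_M(y_i)$ is the one containing $y_i$. For $x\in T\setminus\{y_1,y_2,y_3\}$ let $v(x)$ be the vertex with $x\in R_M(v(x))$ (ties on boundaries broken arbitrarily), and for $z\in T$ let $\ell(v(x),z)$ be the line through $z$ parallel to the edge opposite $v(x)$. For $r\in[1,\infty)$ put $$N^r_{PE}(x,M)=\{z\in T:\ d(v(x),\ell(v(x),z))\le r\,d(v(x),\ell(v(x),x))\},$$ where $d$ is Euclidean distance; for $x$ a vertex put $N^r_{PE}(x,M)=\{x\}$. Digraph and domination number. For a finite set of points in $T$, the proportional-edge proximity catch digraph has these points as vertices and an arc from $p$ to $q\ne p$ iff $q\in N^r_{PE}(p,M)$. A vertex dominates itself and every vertex to which it has an arc; a dominating set is a set of vertices such that each vertex is dominated by one of them; the domination number is the minimum size of a dominating set. Multiple triangles. $T_e$ is the triangle with vertices $(0,0),(1,0),(1/2,\sqrt3/2)$. For each Delaunay triangle $T_j$ fix an affine bijection $A_j:T_e\to T_j$; $M^j=A_j(M)$. With $n_j$ data points in $T_j$ (and $n=\sum_jn_j$), $\gamma_{n_j}(r,M^j)$ is the domination number of the digraph on these points built with $N^r_{PE}(\cdot,M^j)$ in $T_j$, $\gamma_{n,m}(r,M)=\sum_{j=1}^{J_m}\gamma_{n_j}(r,M^j)$,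 and $\overline{G}(r,M)=\gamma_{n,m}(r,M)/J_m$. As $n\to\infty$ every $n_j\to\infty$. Alternatives. In $T_e$ with vertices $y_1,y_2,y_3$ and opposite edges $e_1,e_2,e_3$, let $\ell_j(x)$ be the line through $x$ parallel to $e_j$, $T_j(\varepsilon)=\{x\in T_e:d(y_j,\ell_j(x))\le\varepsilon\}$ and $\mathcal{T}_\varepsilon=\bigcup_{j=1}^3T_j(\varepsilon)$. For $\varepsilon\in(0,\sqrt3/3)$, in one triangle, $H^S_\varepsilon$ (segregation) means the $X_i$ are iid uniform on $T_e\setminus\mathcal{T}_\varepsilon$, and $H^A_\varepsilon$ (association) means the $X_i$ are iid uniform on $\mathcal{T}_{\sqrt3/3-\varepsilon}$. In the multiple-triangle case, $H^S_\varepsilon$ (resp. $H^A_\varepsilon$) means that, given the counts $n_j$, points in different triangles are independent and the points in each $T_j$, mapped to $T_e$ by $A_j^{-1}$, follow the one-triangle alternative $H^S_\varepsilon$ (resp. $H^A_\varepsilon$). Special points and $p_r$. For $r\in(1,3/2]$, $t_i(r)$ is the point of $T_e$ with barycentric coordinate $(2-r)/r$ at the $i$-th vertex and $(r-1)/r$ at each of the other two. Let $\gamma_n(r,M)$ be the domination number of the digraph for $n$ iid uniform points in a single triangle; then $p_r=\lim_{n\to\infty}P(\gamma_n(r,M)=2)$ for $M\in\{t_1(r),t_2(r),t_3(r)\}$. For $r\in(1,3/2)$, $$p_r=\int_0^\infty\!\!\int_0^\infty \frac{64r^2}{9(r-1)^2}\,w_1w_3\exp\!\Big(-\frac{4r}{3(r-1)}\big(w_1^2+w_3^2+2r(r-1)w_1w_3\big)\Big)\,dw_3\,dw_1,$$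 while $p_{3/2}\approx0.7413$ is given by the limit definition and not by this formula.
   Formalization: The formal theorem assumes the mean domination number converges in probability to a constant (it need not for every ε, e.g. under association with small ε and r<3/2) and excludes ties where √J_m(limit−μ)/σ equals the critical value, where the strict test fails. *)

(* Defs.v *)
From HB Require Import structures.
From mathcomp Require Export all_boot all_order all_algebra.
From mathcomp Require Export all_classical all_reals all_analysis.
Export Order.TTheory GRing.Theory Num.Theory.
Export numFieldNormedType.Exports.

Set Implicit Arguments.
Unset Strict Implicit.
Unset Printing Implicit Defensive.

Global Open Scope classical_set_scope.
Global Open Scope ring_scope.

Section PlaneGeometry.
Context {R : realType}.
Implicit Types (a b p q x z M : R * R) (L : set (R * R)) (y : 'I_3 -> R * R).

(* The norm of [R * R] in the library is the sup norm, so the Euclidean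
   distance has to be introduced by hand. *)
Definition edist p q : R := Num.sqrt ((p.1 - q.1) ^+ 2 + (p.2 - q.2) ^+ 2).

Definition edist_set p L : R := inf [set edist p q | q in L].

Definition line a b : set (R * R) := [set (1 - t) *: a + t *: b | t in setT].

Definition segment a b : set (R * R) :=
  [set (1 - t) *: a + t *: b | t in `[0, 1]].

Definition hull (I : finType) (Y : I -> R * R) (S : {set I}) : set (R * R) :=
  [set x | exists w : I -> R, [/\ forall i, 0 <= w i,
     \sum_(i in S) w i = 1 & x = \sum_(i in S) w i *: Y i]].

(* A triangle is given by its vertices [y : 'I_3 -> R * R]; the indices are
   added modulo 3, so [i + 1] and [i + 2] are the two indices other than [i]. *)
Definition triangle y : set (R * R) := hull y [set: 'I_3]%SET.

Definition edge y (i : 'I_3) : set (R * R) := segment (y (i + 1)) (y (i + 2)).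

Definition parallel_line y (i : 'I_3) z : set (R * R) :=
  line z (z + (y (i + 2) - y (i + 1))).

Definition vertex_dist y (i : 'I_3) z : R :=
  edist_set (y i) (parallel_line y i z).

Definition cuts y M : set (R * R) :=
  [set q | exists i Mi, [/\ line (y i) M Mi, edge y i Mi & segment M Mi q]].

Definition vertex_region y M (i : 'I_3) : set (R * R) :=
  closure (connected_component (triangle y `\` cuts y M) (y i)).

(* [v] is a rule attaching to each point the vertex of a region containing it.
   Ties are broken arbitrarily, but measurably, so that the domination number
   of a random sample is a random variable. *)
Definition vertex_rule y M (v : R * R -> 'I_3) : Prop :=
  (forall x, (triangle y `\` range y) x -> vertex_region y M (v x) x) /\
  (forall i, measurable (v @^-1` [set i])).

Definition prox_region y (v : R * R -> 'I_3) (r : R) x : set (R * R) :=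
  [set z | (range y x /\ z = x) \/
     [/\ ~ range y x, triangle y z &
         vertex_dist y (v x) z <= r * vertex_dist y (v x) x]].

End PlaneGeometry.

Section Domination.

Definition dominating (V : finType) (arc : rel V) (D : {set V}) : bool :=
  [forall q, [exists p in D, (p == q) || arc p q]].

Definition domination_number (V : finType) (arc : rel V) : nat :=
  \big[minn/#|V|]_(D : {set V} | dominating arc D) #|D|.

Context {R : realType}.

(* The vertices are the indices of the sample.  Points with distinct indices
   may coincide (an event of probability zero for continuous data), but they
   then dominate each other, since a point of
   the triangle belongs to its own proximity region. *)
Definition pe_arc (y : 'I_3 -> R * R) (v : R * R -> 'I_3) (r : R) (n : nat)
    (X : 'I_n -> R * R) : rel 'I_n :=
  fun p q => (p != q) && `[< prox_region y v r (X p) (X q) >].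

Definition pe_gamma (y : 'I_3 -> R * R) (v : R * R -> 'I_3) (r : R) (n : nat)
    (X : 'I_n -> R * R) : nat :=
  domination_number (pe_arc y v r X).

End Domination.

Section StandardTriangle.
Context {R : realType}.

Definition ye (i : 'I_3) : R * R :=
  nth (0, 0) [:: (0, 0); (1, 0); (2^-1, Num.sqrt 3 / 2)] i.

Definition Te : set (R * R) := triangle ye.

Definition special_point (r : R) (i : 'I_3) : R * R :=
  ((2 - r) / r) *: ye i + ((r - 1) / r) *: ye (i + 1)
    + ((r - 1) / r) *: ye (i + 2).

Definition corners (e : R) : set (R * R) :=
  \bigcup_(j in [set: 'I_3]) [set x | Te x /\ vertex_dist ye j x <= e].

Definition segregation_support (e : R) : set (R * R) := Te `\` corners e.

Definition association_support (e : R) : set (R * R) :=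
  corners (Num.sqrt 3 / 3 - e).

End StandardTriangle.

Section Probability.
Context {R : realType} {d : measure_display} {Omega : measurableType d}
        (P : probability Omega R).

Definition plane_measure : set (R * R) -> \bar R :=
  (@lebesgue_measure R \x @lebesgue_measure R)%E.

Definition uniform_law (X : Omega -> R * R) (D : set (R * R)) : Prop :=
  forall E, measurable E ->
    P (X @^-1` E) =
    (fine (plane_measure (E `&` D)) / fine (plane_measure D))%:E.

(* Taking some of the events to be the whole plane gives the product rule for
   every subfamily. *)
Definition mutually_independent (I : finType) (X : I -> {RV P >-> (R * R)%type}) : Prop :=
  forall E : I -> set (R * R), (forall i, measurable (E i)) ->
    P (\bigcap_(i in [set: I]) (X i @^-1` E i)) =
    (\prod_(i : I) P (X i @^-1` E i))%E.

Definition cvg_in_probability (X : nat -> Omega -> R) (c : R) : Prop :=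
  forall e : R, 0 < e ->
    (fun n => P [set w | `|X n w - c| < e]) @ \oo --> 1%E.

End Probability.

Section Delaunay.
Context {R : realType} {m : nat}.
Implicit Type Y : 'I_m -> R * R.

Definition no_three_collinear Y : Prop :=
  forall i j k : 'I_m, i != j -> i != k -> j != k -> ~ line (Y i) (Y j) (Y k).

Definition no_four_cocircular Y : Prop :=
  forall (o : R * R) (rho : R), (#|[pred i | edist (Y i) o == rho]| <= 3)%N.

Definition delaunay_triple Y (S : {set 'I_m}) : Prop :=
  #|S| = 3%N /\ exists (o : R * R) (rho : R),
    (forall i, i \in S -> edist (Y i) o = rho) /\
    (forall i, rho <= edist (Y i) o).

Definition delaunay Y : {set {set 'I_m}} :=
  finset (fun S => `[< delaunay_triple Y S >]).

Definition num_triangles Y : nat := #|delaunay Y|.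

Definition delaunay_triangle Y (j : 'I_(num_triangles Y)) : set (R * R) :=
  hull Y (enum_val j).

End Delaunay.

Section Charts.
Context {R : realType}.

Definition affine (f : R * R -> R * R) : Prop :=
  forall (t : R) p q, f ((1 - t) *: p + t *: q) = (1 - t) *: f p + t *: f q.

(* [f] is an affine bijection from [Te] onto [T], with inverse [g]; as [Te] is
   not contained in a line, [f] extends to a bijection of the plane. *)
Definition affine_chart (T : set (R * R)) (f g : R * R -> R * R) : Prop :=
  [/\ affine f, cancel f g, cancel g f & f @` Te = T].

End Charts.

Section Test.
Context {R : realType}.

Definition mean_gamma (J : nat) (A : 'I_J -> R * R -> R * R)
    (v : 'I_J -> R * R -> 'I_3) (r : R) (N : 'I_J -> nat)
    (X : {j : 'I_J & 'I_(N j)} -> R * R) : R :=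
  (\sum_(j < J)
     (pe_gamma (A j \o ye) (v j) r
        (fun i : 'I_(N j) => X (Tagged (fun j => 'I_(N j)) i)))%:R) / J%:R.

Definition null_mean (p : R) : R := 3 - p.

Definition null_sd (p : R) : R := Num.sqrt (p * (1 - p)).

Definition test_stat (J : nat) (p g : R) : R :=
  Num.sqrt J%:R * (g - null_mean p) / null_sd p.

Definition Phi (z : R) : R := fine (normal_prob 0 1 `]-oo, z]).

Definition quantile (a : R) : R := get [set z | Phi z = a].

(* [g] is the constant limiting value of the mean domination number. *)
Definition Jstar (p a g : R) : int :=
  Num.ceil ((null_sd p * quantile a / (g - null_mean p)) ^+ 2).

(* Conditionally on the counts [N], the points are mutually independent and,
   after pulling back to [Te], uniformly distributed on [D]. *)
Definition sample_under {d : measure_display} {Omega : measurableType d}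
    (P : probability Omega R) (J : nat) (Ainv : 'I_J -> R * R -> R * R)
    (D : set (R * R)) (N : 'I_J -> nat)
    (X : {j : 'I_J & 'I_(N j)} -> {RV P >-> (R * R)%type}) : Prop :=
  mutually_independent X /\ forall k, uniform_law P (Ainv (tag k) \o X k) D.

End Test.

(* Main.v *)
(* In barycentric coordinates b on T_e, and with s = (r - 1) / r, the point
   M = t_i(r) has b_i = 1 - 2s and b_k = s for k <> i, and a point x in the region
   of y_k reaches exactly the z with b_k(z) >= r (b_k(x) - s).  Hence only the
   sample points close to M and close to the vertices matter:
   - if a neighbourhood of M of radius proportional to u is empty, no point in the
     region of y_k reaches a point whose k-th coordinate is below u, so sample
     points within u of all three vertices force gamma >= 3;
   - two points near M, in the regions of the two vertices other than y_i, reach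
     everything except a small parallelogram at y_i; if that is empty, gamma <= 2.
   With u of order n^(-1/2) the sets to be avoided have probability O(1/n) and those
   to be hit at least a/n with a as large as wanted, so, by independence, such
   configurations occur in all the triangles at once with probability bounded
   away from 0.  No limit law is needed: under the null hypothesis this gives
   0 < p < 1; under segregation the corner y_i is removed, so gamma <= 2; under
   association gamma >= 3 has non-vanishing probability.  As the mean domination
   number converges in probability to the constant g, this forces
   g <= 2 < 3 - p, respectively g >= 3 > 3 - p, and then J_m >= J^* puts the
   limit of the statistic strictly beyond the critical value. *)
Require Import Defs.
From mathcomp Require Import measurable_realfun ring lra.

Set Implicit Arguments.
Unset Strict Implicit.
Unset Printing Implicit Defensive.

(** * Barycentric coordinates *)

Section Barycentric.
Context {R : realType}.
Implicit Types (x z : R * R) (i j k : 'I_3).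

Lemma I3_cases i : [\/ i = 0, i = 1 | i = 2].
Proof.
case: i => [[|[|[|//]]] Hi];
  [apply: Or31|apply: Or32|apply: Or33]; exact: val_inj.
Qed.

Lemma I3_cyc i j : [\/ j = i, j = i + 1 | j = i + 2].
Proof.
case: (I3_cases i) => ->; case: (I3_cases j) => ->;
  by [apply: Or31; apply: val_inj | apply: Or32; apply: val_inj
     | apply: Or33; apply: val_inj].
Qed.

Lemma I3_neq1 i : (i + 1 != i). Proof. by case: (I3_cases i) => ->. Qed.
Lemma I3_neq2 i : (i + 2 != i). Proof. by case: (I3_cases i) => ->. Qed.
Lemma I3_neq12 i : (i + 1 != i + 2). Proof. by case: (I3_cases i) => ->. Qed.

Lemma sum_cyc (V : nmodType) (F : 'I_3 -> V) i :
  \sum_j F j = F i + F (i + 1) + F (i + 2).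
Proof.
have E a b : (a == b :> 'I_3) -> F a = F b by move/eqP->.
rewrite 3!big_ord_recl big_ord0 addr0.
case: (I3_cases i) => ->.
- by rewrite addrA; congr (_ + _ + _); apply: E.
- rewrite addrC; congr (_ + _); last exact: E.
  by congr (_ + _); apply: E.
- rewrite addrA addrC addrA; congr (_ + _); last exact: E.
  by congr (_ + _); apply: E.
Qed.

Lemma ye0 : ye 0 = (0, 0) :> R * R. Proof. by []. Qed.
Lemma ye1 : ye 1 = (1, 0) :> R * R. Proof. by []. Qed.
Lemma ye2 : ye 2 = (2^-1, Num.sqrt 3 / 2) :> R * R. Proof. by []. Qed.

(** Closed affine formulas for the barycentric coordinates with respect to the vertices of [Te];
    [bary_decomp] and [bary_comb] justify the name. *)
Definition bary x i : R :=
  nth 0 [:: 1 - x.1 - x.2 / Num.sqrt 3; x.1 - x.2 / Num.sqrt 3;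
            2 * x.2 / Num.sqrt 3] i.

Lemma bary0 x : bary x 0 = 1 - x.1 - x.2 / Num.sqrt 3. Proof. by []. Qed.
Lemma bary1 x : bary x 1 = x.1 - x.2 / Num.sqrt 3. Proof. by []. Qed.
Lemma bary2 x : bary x 2 = 2 * x.2 / Num.sqrt 3. Proof. by []. Qed.
Definition baryE := (bary0, bary1, bary2).

Lemma sqrt3_gt0 : 0 < Num.sqrt 3 :> R.
Proof. by rewrite sqrtr_gt0. Qed.

Lemma sqrt3_neq0 : Num.sqrt 3 != 0 :> R.
Proof. by rewrite gt_eqF ?sqrt3_gt0. Qed.

Lemma sqr_sqrt3 : Num.sqrt 3 ^+ 2 = 3 :> R.
Proof. by rewrite sqr_sqrtr. Qed.

Lemma sum_bary x : \sum_i bary x i = 1.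
Proof. by rewrite (sum_cyc _ 0) add0r add0r !baryE; field; exact: sqrt3_neq0. Qed.

Lemma bary_cyc x i : bary x i + bary x (i + 1) + bary x (i + 2) = 1.
Proof. by rewrite -sum_cyc sum_bary. Qed.

Lemma bary_decomp x : x = \sum_i bary x i *: ye i.
Proof.
rewrite (sum_cyc _ 0) !add0r !baryE ye0 ye1 ye2; case: x => a b.
have q0 := sqrt3_neq0.
by congr (_, _) => /=; rewrite /GRing.scale /=; field.
Qed.

Lemma pair_eq (a b a' b' : R) : a = a' -> b = b' -> (a, b) = (a', b').
Proof. by move=> -> ->. Qed.

Lemma bary_comb (w : 'I_3 -> R) i :
  \sum_j w j = 1 -> bary (\sum_j w j *: ye j) i = w i.
Proof.
rewrite !(sum_cyc _ 0) !add0r ye0 ye1 ye2 => w1.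
have q0 := sqrt3_neq0.
have w0 : w 0 = 1 - w 1 - w 2 by rewrite -w1; ring.
case: (I3_cases i) => ->; rewrite !baryE /= /GRing.scale /= ?w0;
  by field.
Qed.

Lemma bary_inj x z : bary x =1 bary z -> x = z.
Proof.
by move=> xz; rewrite [x]bary_decomp [z]bary_decomp; apply: eq_bigr => i _; rewrite xz.
Qed.

Lemma bary_ye i j : bary (ye i) j = (i == j)%:R.
Proof.
have q0 := sqrt3_neq0.
by case: (I3_cases i) => ->; case: (I3_cases j) => ->;
  rewrite !baryE ?ye0 ?ye1 ?ye2 /=; field.
Qed.

Lemma TeP x : Te x <-> forall i, 0 <= bary x i.
Proof.
split=> [[w [w0 w1 ->]] i|b0].
  rewrite (eq_bigl (fun=> true)) in w1; last by move=> k; rewrite inE.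
  under eq_bigl => k do rewrite inE.
  by rewrite bary_comb.
exists (bary x); split => //.
  by under eq_bigl => k do rewrite inE; rewrite sum_bary.
by under eq_bigl => k do rewrite inE; exact: bary_decomp.
Qed.

Lemma bary_affine t x z i :
  bary ((1 - t) *: x + t *: z) i = (1 - t) * bary x i + t * bary z i.
Proof.
have q0 := sqrt3_neq0.
by case: (I3_cases i) => ->; rewrite !baryE /= /GRing.scale /=; field.
Qed.

Lemma range_yeP x : range ye x <-> exists i, bary x i = 1 /\ forall j, j != i -> bary x j = 0.
Proof.
split=> [[i _ <-]|[i [bi bj]]].
  by exists i; split => [|j ji]; rewrite bary_ye ?eqxx // eq_sym (negbTE ji).
exists i => //; apply: bary_inj => j; rewrite bary_ye eq_sym.
by case: (eqVneq j i) => [->//|ji]; rewrite bj.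
Qed.

Lemma bary_special (r : R) i j : r != 0 ->
  bary (special_point r i) j = if j == i then (2 - r) / r else (r - 1) / r.
Proof.
move=> r0.
have -> : special_point r i
    = \sum_k (if k == i then (2 - r) / r else (r - 1) / r) *: ye k.
  by rewrite (sum_cyc _ i) eqxx (negbTE (I3_neq1 i)) (negbTE (I3_neq2 i)).
rewrite bary_comb // (sum_cyc _ i) eqxx (negbTE (I3_neq1 i)) (negbTE (I3_neq2 i)).
by field.
Qed.

End Barycentric.

(** * Distances to edges and affine charts *)

Lemma big_setT_I3 (V : nmodType) (F : 'I_3 -> V) :
  \sum_(i in [set: 'I_3]%SET) F i = \sum_i F i.
Proof. by apply: eq_bigl => i; rewrite inE. Qed.

Section Distance.
Context {R : realType}.
Implicit Types (e p x z : R * R) (i j k : 'I_3).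

Lemma inf_attained (S : set R) a : S a -> lbound S a -> inf S = a.
Proof.
move=> Sa lba; apply/eqP; rewrite eq_le ge_inf//=; last by exists a.
by apply: lb_le_inf => //; exists a.
Qed.

Definition cross x z : R := x.1 * z.2 - x.2 * z.1.

(** Area of the parallelogram spanned by [p - z] and [e], divided by its base. *)
Lemma edist_line p z e : e != 0 ->
  edist_set p (line z (z + e))
  = `|cross (p - z) e| / Num.sqrt (e.1 ^+ 2 + e.2 ^+ 2).
Proof.
case: p z e => [p1 p2] [z1 z2] [e1 e2] e0.
have n0 : 0 < e1 ^+ 2 + e2 ^+ 2.
  rewrite lt_neqAle addr_ge0 ?sqr_ge0 // andbT eq_sym.
  apply: contra e0; rewrite paddr_eq0 ?sqr_ge0 // !sqrf_eq0.
  by move=> /andP[/eqP-> /eqP->].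
have s0 : 0 < Num.sqrt (e1 ^+ 2 + e2 ^+ 2) by rewrite sqrtr_gt0.
apply: inf_attained => /=.
  (* Parameter of the foot of the perpendicular from [p], where the infimum is attained. *)
  pose t := ((p1 - z1) * e1 + (p2 - z2) * e2) / (e1 ^+ 2 + e2 ^+ 2).
  exists (z1 + t * e1, z2 + t * e2).
    by exists t => //=; apply: pair_eq; rewrite /= /GRing.scale /=; ring.
  apply/eqP; rewrite -(@eqrXn2 _ 2) ?divr_ge0 ?sqrtr_ge0 //; apply/eqP.
  rewrite expr_div_n real_normK ?num_real // !sqr_sqrtr ?addr_ge0 ?sqr_ge0 //.
  by rewrite /cross /= /t; field; rewrite gt_eqF.
move=> _ [_ [t _ <-] <-]; rewrite -(@ler_pXn2r _ 2) ?nnegrE ?divr_ge0 ?sqrtr_ge0 //.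
rewrite expr_div_n real_normK ?num_real // !sqr_sqrtr ?addr_ge0 ?sqr_ge0 //.
rewrite ler_pdivrMr // /cross /= /GRing.scale /= -subr_ge0.
set u := (X in 0 <= X).
(* Lagrange's identity: the product of the squared norms minus the squared cross product is the
   squared inner product. *)
suff -> : u = ((p1 - z1 - t * e1) * e1 + (p2 - z2 - t * e2) * e2) ^+ 2.
  exact: sqr_ge0.
by rewrite /u; ring.
Qed.

Lemma cross_ye z i :
  cross (ye i - z) (ye (i + 2) - ye (i + 1)) = - (Num.sqrt 3 / 2 * (1 - bary z i)).
Proof.
have q0 := @sqrt3_neq0 R.
have q2 := @sqr_sqrt3 R.
have qV : (Num.sqrt 3)^-1 = Num.sqrt 3 / 3 :> R.
  by apply: (mulfI q0); rewrite mulfV // mulrA -expr2 q2 mulfV.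
have E a b : (a == b :> 'I_3) -> ye a = ye b :> R * R by move/eqP->.
case: (I3_cases i) => ->.
- rewrite (E (0 + 2) 2) // (E (0 + 1) 1) // ye0 ye1 ye2 baryE /cross /=.
  by rewrite ?qV; set q := Num.sqrt 3 in q2 *; field: q2.
- rewrite (E (1 + 2) 0) // (E (1 + 1) 2) // ye0 ye1 ye2 baryE /cross /=.
  by rewrite ?qV; set q := Num.sqrt 3 in q2 *; field: q2.
- rewrite (E (2 + 2) 1) // (E (2 + 1) 0) // ye0 ye1 ye2 baryE /cross /=.
  by rewrite ?qV; set q := Num.sqrt 3 in q2 *; field: q2.
Qed.

End Distance.

Section Chart.
Context {R : realType} (T : set (R * R)) (A Ainv : R * R -> R * R).
Hypothesis hA : affine_chart T A Ainv.
Implicit Types (p q x z : R * R) (i j k : 'I_3).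

Let col1 := A (1, 0) - A 0.
Let col2 := A (0, 1) - A 0.

Lemma affine_form x : A x = A 0 + x.1 *: col1 + x.2 *: col2.
Proof.
case: hA => aff _ _ _; case: x => a b /=.
(* [affine] speaks of combinations of two points only, so [(a, b)] is written as the midpoint of
   [(2a, 0)] and [(0, 2b)]. *)
have -> : (a, b) = (1 - 2^-1) *: ((1 - 2 * a) *: 0 + (2 * a) *: (1, 0))
    + 2^-1 *: ((1 - 2 * b) *: 0 + (2 * b) *: (0, 1)) :> R * R.
  by apply: pair_eq; rewrite /= /GRing.scale /=; field.
rewrite !aff /col1 /col2; case: (A 0) (A (1, 0)) (A (0, 1)) => [u1 u2] [v1 v2] [w1 w2].
by apply: pair_eq; rewrite /= /GRing.scale /=; field.
Qed.

(** With determinant 0, two cofactor combinations of the columns vanish; injectivity then makes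
    every entry 0, and a zero linear part contradicts injectivity. *)
Lemma chart_det_neq0 : cross col1 col2 != 0.
Proof.
case: hA => _ /can_inj Ainj _ _; apply/eqP => det0.
have E a b : a *: col1 + b *: col2 = 0 -> a = 0 /\ b = 0.
  move=> h; have : A (a, b) = A 0 by rewrite affine_form -addrA h addr0.
  by move/Ainj => [].
move: det0 E; rewrite /cross; case: col1 col2 => [a b] [c d] /= det0 E.
have [] := E (- d) b.
  by apply: pair_eq; rewrite /= /GRing.scale /=; [rewrite -oppr0 -det0|]; ring.
move=> /eqP; rewrite oppr_eq0 => /eqP d0 b0.
have [] := E (- c) a.
  by apply: pair_eq; rewrite /= /GRing.scale /=; [|rewrite -det0]; ring.
move=> /eqP; rewrite oppr_eq0 => /eqP c0 a0.
have [] := E 1 0; last by move/eqP; rewrite oner_eq0.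
by apply: pair_eq; rewrite /= /GRing.scale /= ?a0 ?b0 ?c0 ?d0; ring.
Qed.

Lemma chart_cross p q x z :
  cross (A p - A q) (A x - A z) = cross col1 col2 * cross (p - q) (x - z).
Proof.
rewrite (affine_form p) (affine_form q) (affine_form x) (affine_form z).
case: (A 0) col1 col2 p q x z => ? ? [? ?] [? ?] [? ?] [? ?] [? ?] [? ?].
by rewrite /cross /= /GRing.scale /=; ring.
Qed.

(** The direction of the lines is fixed and a chart scales areas by its determinant, so all these
    distances are scaled by one factor [h]. Comparing them thus amounts to comparing barycentric
    coordinates. *)
Lemma chart_vertex_dist i :
  exists2 h, 0 < h & forall z, vertex_dist (A \o ye) i (A z) = h * `|1 - bary z i|.
Proof.
case: (hA) => _ /can_inj Ainj _ _.
set e := A (ye (i + 2)) - A (ye (i + 1)).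
have e0 : e != 0.
  rewrite subr_eq0; apply/negP => /eqP/Ainj/(congr1 (fun x => bary x (i + 1))).
  rewrite !bary_ye eqxx eq_sym (negbTE (I3_neq12 i)) => /eqP.
  by rewrite eq_sym oner_eq0.
have n0 : 0 < Num.sqrt (e.1 ^+ 2 + e.2 ^+ 2).
  rewrite sqrtr_gt0 lt_neqAle addr_ge0 ?sqr_ge0 // andbT eq_sym.
  move: e0; case: (e) => [e1 e2]; apply: contra.
  by rewrite paddr_eq0 ?sqr_ge0 // !sqrf_eq0 => /andP[/= /eqP-> /eqP->].
exists (`|cross col1 col2| * (Num.sqrt 3 / 2) / Num.sqrt (e.1 ^+ 2 + e.2 ^+ 2)).
  by rewrite !mulr_gt0 ?invr_gt0 ?normr_gt0 ?chart_det_neq0 ?sqrt3_gt0.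
move=> z; rewrite /vertex_dist /parallel_line /= -/e edist_line //.
rewrite /e chart_cross cross_ye -/e !(normrM, normrN).
rewrite (@ger0_norm _ (Num.sqrt 3)) ?sqrtr_ge0 // (@ger0_norm _ 2^-1) ?invr_ge0 //.
by rewrite -!mulrA; congr (_ * (_ * (_ * _))); rewrite mulrC.
Qed.

Lemma chart_sum (w : 'I_3 -> R) :
  \sum_i w i = 1 -> A (\sum_i w i *: ye i) = \sum_i w i *: A (ye i).
Proof.
move=> w1.
rewrite (eq_bigr _ (fun i _ => congr1 (GRing.scale (w i)) (affine_form (ye i)))).
rewrite affine_form; move: w1; rewrite !(sum_cyc _ 0).
move: (w 0) (w (0 + 1)) (w (0 + 2)) (ye 0) (ye (0 + 1)) (ye (0 + 2)).
move: (A 0) col1 col2 => [? ?] [? ?] [? ?] a b c [? ?] [? ?] [? ?] abc.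
have -> : a = 1 - b - c by rewrite -abc; ring.
by apply: pair_eq; rewrite /= /GRing.scale /=; ring.
Qed.

Lemma chart_triangle z : triangle (A \o ye) (A z) <-> Te z.
Proof.
case: (hA) => _ /can_inj Ainj _ _.
split=> [[w [w0 w1 e]]|[w [w0 w1 e]]]; exists w; split => //.
- move: w1 e; rewrite !big_setT_I3 => w1.
  by rewrite -chart_sum // => /Ainj.
- by move: w1; rewrite e !big_setT_I3 => w1; rewrite chart_sum.
Qed.

Lemma chart_range z : range (A \o ye) (A z) <-> range ye z.
Proof.
case: (hA) => _ /can_inj Ainj _ _.
by split => -[i _ e]; exists i => //=; [exact: Ainj|rewrite e].
Qed.

Lemma chart_prox_region (v : R * R -> 'I_3) (r : R) x z :
  prox_region (A \o ye) v r (A x) (A z) <->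
  (range ye x /\ z = x) \/
  [/\ ~ range ye x, Te z &
      `|1 - bary z (v (A x))| <= r * `|1 - bary x (v (A x))|].
Proof.
case: (hA) => _ /can_inj Ainj _ _.
have [h h0 hE] := chart_vertex_dist (v (A x)).
rewrite /prox_region /= !hE mulrCA ler_pM2l //.
split.
  case=> [[/chart_range xr /Ainj zx]|[nx /chart_triangle tz le]]; first by left.
  by right; split => // /chart_range.
case=> [[/chart_range xr ->]|[nx /chart_triangle tz le]]; first by left.
by right; split => // /chart_range.
Qed.

Lemma chart_cuts M z : cuts ye M z -> cuts (A \o ye) (A M) (A z).
Proof.
case: hA => aff _ _ _ [i [Mi [[t _ <-] [u u01 e] [s s01 <-]]]].
exists i, (A ((1 - t) *: ye i + t *: M)); split.
- by exists t => //; rewrite aff.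
- by exists u => //; rewrite -e aff.
- by exists s => //; rewrite aff.
Qed.

End Chart.

(** * Vertex regions *)

Lemma I3_eqs (i : 'I_3) : ((i == i + 1) = false) * ((i == i + 2) = false) *
  ((i + 1 == i) = false) * ((i + 2 == i) = false) *
  ((i + 1 == i + 2) = false) * ((i + 2 == i + 1) = false) *
  ((i == i) = true) * ((i + 1 == i + 1) = true) * ((i + 2 == i + 2) = true).
Proof. by case: (I3_cases i) => ->. Qed.

Section VertexRegion.
Context {R : realType}.
Implicit Types (x z M : R * R) (i j k l : 'I_3).

(** The equality puts [z] on the line through [y_l] and [M]; the inequality puts it beyond [M] as
    seen from [y_l], hence on the segment from [M] to the opposite edge. *)
Lemma tie_cuts M z l : (forall j, 0 < bary M j) -> Te z ->
  bary z (l + 1) * bary M (l + 2) = bary z (l + 2) * bary M (l + 1) ->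
  bary z l * bary M (l + 1) <= bary z (l + 1) * bary M l ->
  cuts ye M z.
Proof.
move=> M0 /TeP z0 tie le.
have Ms := bary_cyc M l; have zs := bary_cyc z l.
have := (M0 l, M0 (l + 1), M0 (l + 2)) => -[[]].
have := (z0 l, z0 (l + 1), z0 (l + 2)) => -[[]].
set m0 := bary M l in le Ms *; set m1 := bary M (l + 1) in tie le Ms *.
set m2 := bary M (l + 2) in tie Ms *; set b0 := bary z l in le zs *.
set b1 := bary z (l + 1) in tie le zs *; set b2 := bary z (l + 2) in tie zs *.
move=> b0ge b1ge b2ge m0gt m1gt m2gt.
have m12 : 0 < 1 - m0 by lra.
have b1E : b1 = (1 - b0) * m1 / (1 - m0).
  apply: (canRL (mulfK _)); first by rewrite gt_eqF.
  have -> : 1 - m0 = m1 + m2 by lra.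
  have -> : 1 - b0 = b1 + b2 by lra.
  by rewrite mulrDr tie; ring.
have b0le : b0 <= m0.
  have le2 : b0 * m2 <= b2 * m0.
    rewrite -(ler_pM2r m1gt) [leLHS](_ : _ = (b0 * m1) * m2); last by ring.
    rewrite [leRHS](_ : _ = (b1 * m2) * m0); last by rewrite tie; ring.
    by rewrite [leRHS]mulrAC ler_pM2r.
  have : b0 * (1 - m0) <= (1 - b0) * m0.
    rewrite (_ : 1 - m0 = m1 + m2); last by lra.
    by rewrite (_ : 1 - b0 = b1 + b2) ?mulrDr ?mulrDl ?lerD//; lra.
  lra.
have n0 : 1 - m0 != 0 by rewrite gt_eqF.
have n1 : m0 != 0 by rewrite gt_eqF.
(* At parameter [1 / (1 - m0)] the line from [y_l] through [M] reaches coordinate 0 at [l], that is,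
   the opposite edge. *)
exists l, ((1 - (1 - m0)^-1) *: ye l + (1 - m0)^-1 *: M); split.
- by exists ((1 - m0)^-1).
- exists (m2 / (1 - m0)).
    rewrite /= in_itv /= divr_ge0 ?(ltW m2gt) ?(ltW m12) //=.
    by rewrite ler_pdivrMr // mul1r; lra.
  apply: bary_inj => j; case: (I3_cyc l j) => ->;
    rewrite !bary_affine !bary_ye !I3_eqs /= -/m0 -/m1 -/m2.
  + by field.
  + by rewrite (_ : m1 = 1 - m0 - m2); [field|lra].
  + by field.
- exists (1 - b0 / m0).
    rewrite /= in_itv /= subr_ge0 gerBl divr_ge0 ?(ltW m0gt) // andbT.
    by rewrite ler_pdivrMr // mul1r.
  apply: bary_inj => j; case: (I3_cyc l j) => ->;
    rewrite !bary_affine !bary_ye !I3_eqs /= -/m0 -/m1 -/m2 -/b0 -/b1 -/b2.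
  + by field; rewrite n0 n1.
  + by rewrite b1E; field; rewrite n0 n1.
  + rewrite (_ : b2 = 1 - b0 - b1); last by lra.
    rewrite b1E (_ : m2 = 1 - m0 - m1); last by lra.
    by field; rewrite n0 n1.
Qed.

(* [bary z j / bary M j] is largest at [j = i]. *)
Definition in_region M i z :=
  forall j, bary z j * bary M i <= bary z i * bary M j.

(** A tie for the largest ratio would put [z] on the cut from [M] to the edge opposite the third
    vertex. *)
Lemma in_region_of_no_cut M z i : (forall j, 0 < bary M j) -> Te z ->
  ~ cuts ye M z -> in_region M i z ->
  forall j, j != i -> bary z j * bary M i < bary z i * bary M j.
Proof.
move=> M0 z0 nc reg j ji; rewrite lt_neqAle reg andbT; apply/eqP => tie.
apply: nc; case: (I3_cyc i j) ji tie => ->; rewrite ?eqxx // => _ tie.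
- have e1 : i + 2 + 1 = i by case: (I3_cases i) => ->; apply/eqP.
  have e2 : i + 2 + 2 = i + 1 by case: (I3_cases i) => ->; apply/eqP.
  by apply: (@tie_cuts M z (i + 2)) => //; rewrite ?e1 ?e2.
- have e1 : i + 1 + 1 = i + 2 by case: (I3_cases i) => ->; apply/eqP.
  have e2 : i + 1 + 2 = i by case: (I3_cases i) => ->; apply/eqP.
  apply: (@tie_cuts M z (i + 1)) => //; rewrite ?e1 ?e2 //.
  rewrite -(ler_pM2r (M0 i)) mulrAC.
  rewrite [leRHS](_ : _ = bary z (i + 2) * bary M i * bary M (i + 1)); last by ring.
  by rewrite tie [leRHS]mulrAC ler_pM2r.
Qed.

End VertexRegion.

Lemma measurable_affine_form (R : realType) (a b c : R) :
  measurable_fun setT (fun z : R * R => a + b * z.1 + c * z.2).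
Proof.
apply: measurable_funD.
  apply: measurable_funD; first exact: measurable_cst.
  by apply: measurable_funM; [exact: measurable_cst|exact: measurable_fst].
by apply: measurable_funM; [exact: measurable_cst|exact: measurable_snd].
Qed.

Lemma continuous_affine_form (R : realType) (a b c : R) :
  continuous (fun z : R * R => a + b * z.1 + c * z.2).
Proof.
move=> z; apply: cvgD; first apply: cvgD; first exact: cvg_cst.
  by apply: cvgM; [exact: cvg_cst|exact: cvg_fst].
by apply: cvgM; [exact: cvg_cst|exact: cvg_snd].
Qed.

Section ChartInverse.
Context {R : realType} (T : set (R * R)) (A Ainv : R * R -> R * R).
Hypothesis hA : affine_chart T A Ainv.

Lemma chart_inverse : affine_chart (Ainv @` Te) Ainv A.
Proof.
case: hA => aff AK AinvK _; split => // t p q.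
by rewrite -{1}[p]AinvK -{1}[q]AinvK -aff AK.
Qed.

Lemma bary_chart_affine j : exists a b c, forall z : R * R,
  bary (Ainv z) j = a + b * z.1 + c * z.2.
Proof.
have E := affine_form chart_inverse.
pose u := Ainv (1, 0) - Ainv 0; pose w := Ainv (0, 1) - Ainv 0.
have q0 := @sqrt3_neq0 R.
case: (I3_cases j) => ->.
- exists (bary (Ainv 0) 0), (- u.1 - u.2 / Num.sqrt 3), (- w.1 - w.2 / Num.sqrt 3).
  by move=> z; rewrite E !baryE /= /GRing.scale /=; field.
- exists (bary (Ainv 0) 1), (u.1 - u.2 / Num.sqrt 3), (w.1 - w.2 / Num.sqrt 3).
  by move=> z; rewrite E !baryE /= /GRing.scale /=; field.
- exists (bary (Ainv 0) 2), (2 * u.2 / Num.sqrt 3), (2 * w.2 / Num.sqrt 3).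
  by move=> z; rewrite E !baryE /= /GRing.scale /=; field.
Qed.

Lemma bary_chart_measurable j : measurable_fun setT (fun z => bary (Ainv z) j).
Proof.
have [a [b [c E]]] := bary_chart_affine j.
rewrite (_ : (fun _ => _) = fun z : R * R => a + b * z.1 + c * z.2); last exact/funext.
exact: measurable_affine_form.
Qed.

Lemma chart_inv_measurable : measurable_fun setT Ainv.
Proof.
have E := affine_form chart_inverse.
pose u := Ainv (1, 0) - Ainv 0; pose w := Ainv (0, 1) - Ainv 0.
have mE a b c := @measurable_affine_form R a b c.
apply/measurable_fun_pairP; split.
- rewrite (_ : _ \o _ = fun z : R * R => (Ainv 0).1 + u.1 * z.1 + w.1 * z.2) //.
  by apply/funext => z /=; rewrite {1}E /= /GRing.scale /= !(mulrC z.1, mulrC z.2).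
- rewrite (_ : _ \o _ = fun z : R * R => (Ainv 0).2 + u.2 * z.1 + w.2 * z.2) //.
  by apply/funext => z /=; rewrite {1}E /= /GRing.scale /= !(mulrC z.1, mulrC z.2).
Qed.

End ChartInverse.

Section ChartRegion.
Context {R : realType} (T : set (R * R)) (A Ainv : R * R -> R * R).
Hypothesis hA : affine_chart T A Ainv.

(* Off the cuts the weak inequalities defining [in_region] are strict, so they
   cut out a relatively clopen part of the triangle minus the cuts. *)
Lemma vertex_region_in_region (M z : R * R) i : (forall j, 0 < bary M j) ->
  vertex_region (A \o ye) (A M) i (A z) -> in_region M i z.
Proof.
case: (hA) => _ AK AinvK _ M0 zreg j.
pose F k (x : R * R) := bary (Ainv x) i * bary M k - bary (Ainv x) k * bary M i.
have Fc k : continuous (F k).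
  have [ai [bi [ci Ei]]] := bary_chart_affine hA i.
  have [ak [bk [ck Ek]]] := bary_chart_affine hA k.
  rewrite (_ : F k = fun x : R * R => (ai * bary M k - ak * bary M i)
      + (bi * bary M k - bk * bary M i) * x.1 + (ci * bary M k - ck * bary M i) * x.2).
    exact: continuous_affine_form.
  by apply/funext => x; rewrite /F Ei Ek; ring.
have closedF : closed [set x | forall k, 0 <= F k x].
  rewrite (_ : [set _ | _] = \bigcap_(k in setT) (F k @^-1` [set y | 0 <= y])); last first.
    by apply/seteqP; split => x /= Fx k; [move=> _|]; exact: Fx.
  apply: closed_bigI => k _; apply: closed_comp => [x _|]; first exact: Fc.
  exact: closed_ge.
have openF : open [set x | forall k, k != i -> 0 < F k x].
  rewrite (_ : [set _ | _] =
      (F (i + 1) @^-1` [set y | 0 < y]) `&` (F (i + 2) @^-1` [set y | 0 < y])).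
    apply: openI; apply: open_comp => [x _|]; by [exact: Fc|exact: open_gt].
  apply/seteqP; split => x /= Fx; first by split; apply: Fx; rewrite I3_eqs.
  by move=> k; case: (I3_cyc i k) => ->; rewrite I3_eqs //; case: Fx.
(* The weak inequalities define a closed set, so they pass from the component to its closure. *)
suff sub : connected_component (triangle (A \o ye) `\` cuts (A \o ye) (A M)) ((A \o ye) i)
    `<=` [set x | forall k, 0 <= F k x].
  have /(_ j) : forall k, 0 <= F k (A z).
    by move/closure_id: closedF (closureS sub zreg) => <-.
  by rewrite /F AK subr_ge0.
move=> x [C [Ci Csub Cc] Cx].
have weak_strict w : C w -> (forall k, 0 <= F k w) -> forall k, k != i -> 0 < F k w.
  move=> /Csub[]; rewrite -[w]AinvK => /(chart_triangle hA) w0 nc Fw k ki.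
  rewrite /F AK subr_gt0; apply: in_region_of_no_cut => //.
    by move/(chart_cuts hA).
  by move=> l; rewrite -subr_ge0; have := Fw l; rewrite /F AK.
suff CE : C `&` [set x | forall k, 0 <= F k x] = C by move: Cx; rewrite -{1}CE => -[].
(* Connectedness of [C]: the part satisfying the weak inequalities contains the vertex, is
   relatively open by [weak_strict], and is relatively closed. *)
apply: Cc.
- exists (A (ye i)); split => //= k; rewrite /F AK !bary_ye eqxx mul1r subr_ge0.
  by case: (eqVneq i k) => [->|_]; rewrite ?mul1r // mul0r ltW.
- exists [set x | forall k, k != i -> 0 < F k x] => //.
  apply/seteqP; split => w /= [Cw Fw]; split => //; first exact: weak_strict.
  move=> k; case: (eqVneq k i) => [->|ki]; last exact/ltW/Fw.
  by rewrite /F subrr.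
- by exists [set x | forall k, 0 <= F k x].
Qed.

End ChartRegion.

(** * Deterministic bounds for the domination number *)

Section DominationBounds.
Variables (V : finType) (arc : rel V).

Lemma domination_number_le (D : {set V}) :
  dominating arc D -> (domination_number arc <= #|D|)%N.
Proof.
move=> dD; rewrite /domination_number.
elim: (index_enum _) (mem_index_enum D) => // E l IH; rewrite inE big_cons.
case/predU1P => [<-|/IH le]; first by rewrite dD geq_minl.
by case: ifP => // _; exact: leq_trans (geq_minr _ _) le.
Qed.

Lemma domination_number_ge n :
  (forall D : {set V}, dominating arc D -> (n <= #|D|)%N) ->
  (n <= domination_number arc)%N.
Proof.
move=> H; rewrite /domination_number; elim/big_ind: _ => //.
- rewrite -cardsT; apply: H; apply/forallP => q; apply/existsP; exists q.
  by rewrite inE eqxx.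
- by move=> a b na nb; rewrite leq_min na.
Qed.

Lemma domination_number_le2 p q :
  (forall x, [|| p == x, arc p x, q == x | arc q x]) ->
  (domination_number arc <= 2)%N.
Proof.
move=> H; apply: leq_trans (_ : #|[set p; q]%SET| <= 2)%N; last first.
  by rewrite cards2; case: (p != q).
apply: domination_number_le; apply/forallP => x; apply/existsP.
by have /or4P[h|h|h|h] := H x; [exists p|exists p|exists q|exists q];
  rewrite !inE eqxx ?orbT /= h ?orbT.
Qed.

(** The point [p0] rules out the empty dominating set. *)
Lemma domination_number_ge2 (p0 : V) :
  (forall p, exists x, ~~ ((p == x) || arc p x)) ->
  (2 <= domination_number arc)%N.
Proof.
move=> H; apply: domination_number_ge => D /forallP dD; rewrite ltnNge.
apply/negP; rewrite leq_eqVlt ltnS leqn0 => /orP[/cards1P[p Dp]|/eqP/cards0_eq D0].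
  have [x /negP] := H p; apply; have /existsP[p'] := dD x.
  by rewrite Dp inE => /andP[/eqP ->].
by have /existsP[p'] := dD p0; rewrite D0 inE.
Qed.

Lemma domination_number_ge3 (p0 : V) :
  (forall p q, exists x, ~~ [|| p == x, arc p x, q == x | arc q x]) ->
  (3 <= domination_number arc)%N.
Proof.
move=> H; apply: domination_number_ge => D /forallP dD; rewrite ltnNge.
apply/negP => D2.
have [p [q Dpq]] : exists p q, D \subset [set p; q]%SET.
  move: D2; rewrite leq_eqVlt ltnS => /orP[/cards2P[p [q [_ ->]]]|].
    by exists p, q; rewrite subxx.
  rewrite leq_eqVlt ltnS leqn0 => /orP[/cards1P[p ->]|/eqP/cards0_eq ->].
    by exists p, p; rewrite finset.subsetUl.
  by exists p0, p0; rewrite finset.sub0set.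
have [x /negP] := H p q; apply; have /existsP[p' /andP[/(fintype.subsetP Dpq)]] := dD x.
by rewrite !inE => /orP[] /eqP -> /orP[] ->; rewrite ?orbT.
Qed.

End DominationBounds.

Lemma I3_avoid2 (a b : 'I_3) : exists k, (k != a) && (k != b).
Proof.
case: (I3_cyc a b) => ->.
- by exists (a + 1); rewrite I3_eqs.
- by exists (a + 2); rewrite !I3_eqs.
- by exists (a + 1); rewrite !I3_eqs.
Qed.

Lemma I3_other (i k : 'I_3) : k != i ->
  exists k', [/\ k' != i, k' != k & forall j, [\/ j = i, j = k | j = k']].
Proof.
case: (I3_cyc i k) => ->; rewrite ?eqxx // => _.
- exists (i + 2); rewrite !I3_eqs; split => // j.
  exact: I3_cyc.
- exists (i + 1); rewrite !I3_eqs; split => // j.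
  by case: (I3_cyc i j) => ->; [apply: Or31|apply: Or33|apply: Or32].
Qed.

(** * Reach of a sample point near [M] and near the vertices *)

Section Proximity.
Context {R : realType} (T : set (R * R)) (A Ainv : R * R -> R * R).
Hypothesis hA : affine_chart T A Ainv.
Variables (r : R) (i : 'I_3) (v : R * R -> 'I_3).
Hypothesis hr : 1 < r <= 3 / 2.
Let M := special_point r i.
Hypothesis hv : vertex_rule (A \o ye) (A M) v.
Let s := (r - 1) / r.
Implicit Types (x z : R * R) (j k : 'I_3) (u d rho : R).

(** The condition [r <= 3 / 2] is [s <= 1 / 3], so the coordinate [1 - 2 * s] of [M] at [y_i] is the
    largest one. The last identity turns [1 - z_k <= r * (1 - x_k)] into [z_k >= r * (x_k - s)]. *)
Lemma ratio_bounds : [/\ 0 < r, 0 < s, s <= 1 / 3 & r * (1 - s) = 1].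
Proof.
have /andP[r1 r32] := hr; have r0 : 0 < r by lra.
split => //.
- by rewrite divr_gt0 // subr_gt0.
- by rewrite ler_pdivrMr //; lra.
- by rewrite /s; field; rewrite gt_eqF.
Qed.

Lemma bary_M j : bary M j = if j == i then 1 - 2 * s else s.
Proof.
have [r0 _ _ _] := ratio_bounds.
rewrite (bary_special _ _ (lt0r_neq0 r0)) /s.
by case: ifP => // _; field; rewrite gt_eqF.
Qed.

Lemma bary_M_ge j : s <= bary M j.
Proof. by have [_ _ s3 _] := ratio_bounds; rewrite bary_M; case: ifP => // _; lra. Qed.

Lemma bary_M_gt0 j : 0 < bary M j.
Proof. by have [_ s0 _ _] := ratio_bounds; apply: lt_le_trans s0 (bary_M_ge j). Qed.

Lemma bary_M_le1 j : bary M j <= 1.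
Proof. by have [_ s0 s3 _] := ratio_bounds; rewrite bary_M; case: ifP => // _; lra. Qed.

Lemma bary_le1 z j : Te z -> bary z j <= 1.
Proof.
move=> /TeP z0; have := bary_cyc z j.
by have := z0 (j + 1); have := z0 (j + 2); lra.
Qed.

Lemma in_region_rule z : Te z -> ~ range ye z -> in_region M (v (A z)) z.
Proof.
move=> z0 nz; case: hv => /(_ (A z)) reg _.
apply: (vertex_region_in_region hA bary_M_gt0); apply: reg; split.
  exact/(chart_triangle hA).
by move/(chart_range hA).
Qed.

(* The sets to be hit or avoided are all hexagons of this shape, or complements
   of the support; their area is of order [rho ^+ 2]. *)
Definition hex (c : 'I_3 -> R) (rho : R) : set (R * R) :=
  [set x | forall j, `|bary x j - c j| <= rho].

(** If [bary z k] were below [bary M k + u], maximality of the ratio at [k] would bound every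
    coordinate by that of [M] plus [u / s]. As coordinates sum to 1, none could then drop by more
    than [2 * u / s], and [z] would lie in the hexagon. *)
Lemma in_region_far k z u : 0 < u -> in_region M k z ->
  ~ hex (bary M) (2 * u / s) z -> bary M k + u <= bary z k.
Proof.
have [_ s0 s3 _] := ratio_bounds.
move=> u0 reg nh; rewrite leNgt; apply/negP => lt; apply: nh.
have us : u <= u / s by rewrite ler_pdivlMr // -[leRHS]mulr1 ler_pM2l //; lra.
have up j : bary z j - bary M j <= u / s.
  rewrite ler_pdivlMr // -(ler_pM2l (bary_M_gt0 k)).
  have h1 := reg j; have h2 := bary_M_ge k; have h3 := bary_M_le1 j.
  have h4 := bary_M_gt0 j; have h5 := bary_M_gt0 k.
  have h6 : bary M k * (bary z j - bary M j) <= u * bary M j.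
    have : bary z k * bary M j <= (bary M k + u) * bary M j by rewrite ler_pM2r // ltW.
    by lra.
  apply: le_trans (_ : (u * bary M j) * s <= _).
    by rewrite mulrA ler_pM2r.
  by rewrite [leRHS]mulrC -mulrA ler_pM2l //; apply: le_trans h2; rewrite ler_piMl // ltW.
move=> j; have := up j; have := up (j + 1); have := up (j + 2).
have := bary_cyc M j; have := bary_cyc z j.
rewrite ler_norml (_ : 2 * u / s = 2 * (u / s)); last by rewrite mulrA.
move=> *; apply/andP; split; lra.
Qed.

Definition near_vertex k u z := forall j, j != k -> 0 < bary z j < u.

Lemma near_vertexN k u z : near_vertex k u z -> ~ range ye z.
Proof.
move=> nz /range_yeP[l [_ l0]].
have [j /andP[jk jl]] := I3_avoid2 k l.
by have := nz j jk; rewrite l0 // ltxx.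
Qed.

(** With [l] the label of [x], its coordinate at [y_l] is at least [s + u], so [x] reaches only
    points with coordinate at least [r * u > u] there; the coordinate of [z] at [y_l] is below
    [u]. *)
Lemma near_vertex_not_dominated k u x z : 0 < u -> Te x ->
  ~ hex (bary M) (2 * u / s) x -> Te z -> near_vertex k u z -> k != v (A x) ->
  x <> z /\ ~ prox_region (A \o ye) v r (A x) (A z).
Proof.
have [r0 s0 s3 rs] := ratio_bounds; have /andP[r1 _] := hr.
move=> u0 x0 nh z0 nz kv.
have far : ~ range ye x -> bary M (v (A x)) + u <= bary x (v (A x)).
  by move=> nx; apply: in_region_far => //; exact: in_region_rule.
have /andP[zk0 zku] : 0 < bary z (v (A x)) < u by apply: nz; rewrite eq_sym.
have Ms := bary_M_ge (v (A x)).
split=> [xz|/(chart_prox_region hA)[[xr zx]|[nx _]]].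
- by have := far; rewrite xz => /(_ (near_vertexN nz)); rewrite -xz in zku *; lra.
- by apply: (near_vertexN nz); rewrite zx.
- rewrite !ger0_norm ?subr_ge0 ?bary_le1 //.
  have := far nx; set b := bary x _ => h.
  have : r * (1 - b) <= r * (1 - s - u) by rewrite ler_pM2l //; lra.
  have : 0 < (r - 1) * u by rewrite mulr_gt0 // subr_gt0.
  by lra.
Qed.

(* The points of the region of [y_k], [k != i], lying just beyond the point
   with barycentric coordinates [1 - d] at [y_i] and [d / 2] at the others. *)
Definition beyond d rho k : set (R * R) :=
  [set x | [/\ Te x, bary x i < 1 - d,
     forall j, j != i -> j != k -> bary x j < bary x k
     & d / 2 < bary x k <= d / 2 + rho]].

(** Compared with [M], the coordinate at [i] is smaller and the one at [k] larger, which excludes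
    [y_i]. At the third vertex [M] has the same coordinate [s] as at [k], while that of [x] is
    smaller. *)
Lemma beyond_rule d rho k x : k != i -> 2 * s <= d -> d / 2 + rho < 1 ->
  beyond d rho k x -> ~ range ye x /\ v (A x) = k.
Proof.
have [r0 s0 s3 rs] := ratio_bounds.
move=> ki sd d1 [x0 xi xo /andP[xk1 xk2]].
have nx : ~ range ye x.
  move=> /range_yeP[l [l1 l0]]; case: (eqVneq k l) => [kl|kl].
    by move: l1; rewrite -kl; lra.
  by have := l0 k kl; lra.
split=> //; have reg := in_region_rule x0 nx k; apply/eqP/negP => /negP vk.
have [k' [k'i k'k kc]] := I3_other ki.
case: (kc (v (A x))) vk reg => ->; rewrite ?eqxx // => _.
- rewrite !bary_M eqxx (negbTE ki) => h.
  have : bary x i * s < (1 - 2 * s) * s by rewrite ltr_pM2r //; lra.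
  have : s * (1 - 2 * s) < bary x k * (1 - 2 * s) by rewrite ltr_pM2r; lra.
  by lra.
- rewrite !bary_M (negbTE ki) (negbTE k'i) ler_pM2r // => h.
  by have := xo k' k'i k'k; lra.
Qed.

Lemma beyond_prox d rho k x z : k != i -> 2 * s <= d -> d / 2 + rho < 1 ->
  beyond d rho k x -> Te z -> r * (d / 2 + rho - s) <= bary z k ->
  prox_region (A \o ye) v r (A x) (A z).
Proof.
have [r0 s0 s3 rs] := ratio_bounds.
move=> ki sd d1 Bx z0 zk; have [nx vx] := beyond_rule ki sd d1 Bx.
case: Bx => x0 _ _ /andP[_ xk].
apply/(chart_prox_region hA); right; split => //.
rewrite vx !ger0_norm ?subr_ge0 ?bary_le1 //.
have : r * (1 - (d / 2 + rho)) <= r * (1 - bary x k) by rewrite ler_pM2l //; lra.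
lra.
Qed.

Section Sample.
Variables (n : nat) (X : 'I_n -> R * R).
Let Z p := Ainv (X p).
Hypothesis Z_Te : forall p, Te (Z p).

Let XE p : X p = A (Z p).
Proof. by case: hA => _ _ AinvK _; rewrite /Z AinvK. Qed.

Lemma pe_arc_far u k p q : 0 < u -> ~ hex (bary M) (2 * u / s) (Z p) ->
  near_vertex k u (Z q) -> k != v (X p) ->
  ~~ ((p == q) || pe_arc (A \o ye) v r X p q).
Proof.
move=> u0 hp hq kv.
have [] := near_vertex_not_dominated u0 (Z_Te p) hp (Z_Te q) hq.
  by rewrite -XE.
move=> pq nprox; rewrite negb_or; apply/andP; split.
  by apply/eqP => pqE; apply: pq; rewrite pqE.
by rewrite negb_and; apply/orP; right; apply/asboolPn; rewrite !XE.
Qed.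

(** Two points carry at most two labels; a sample point near a vertex that is not among them escapes
    both. *)
Lemma pe_gamma_ge3 u : 0 < u -> (forall p, ~ hex (bary M) (2 * u / s) (Z p)) ->
  (forall k, exists q, near_vertex k u (Z q)) ->
  (3 <= pe_gamma (A \o ye) v r X)%N.
Proof.
move=> u0 nh hit; have [p0 _] := hit 0.
apply: (domination_number_ge3 p0) => p q.
have [k /andP[kp kq]] := I3_avoid2 (v (X p)) (v (X q)).
have [x hx] := hit k; exists x.
have := pe_arc_far u0 (nh p) hx kp; have := pe_arc_far u0 (nh q) hx kq.
by rewrite !negb_or => /andP[-> ->] /andP[-> ->].
Qed.

(** A single point has one label, so at least one of the two vertices other than [y_i] differs from
    it. *)
Lemma pe_gamma_ge2 u : 0 < u -> (forall p, ~ hex (bary M) (2 * u / s) (Z p)) ->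
  (forall k, k != i -> exists q, near_vertex k u (Z q)) ->
  (2 <= pe_gamma (A \o ye) v r X)%N.
Proof.
move=> u0 nh hit; have [p0 _] := hit (i + 1) (I3_neq1 i).
apply: (domination_number_ge2 p0) => p.
have [k /andP[ki kp]] := I3_avoid2 i (v (X p)).
by have [x hx] := hit k ki; exists x; exact: pe_arc_far hx kp.
Qed.

Lemma pe_gamma_le2 d rho : 2 * s <= d -> d / 2 + rho < 1 ->
  (forall k, k != i -> exists p, beyond d rho k (Z p)) ->
  (forall q, exists2 k, k != i & r * (d / 2 + rho - s) <= bary (Z q) k) ->
  (pe_gamma (A \o ye) v r X <= 2)%N.
Proof.
move=> sd d1 hit cov.
have [p hp] := hit (i + 1) (I3_neq1 i).
have [q hq] := hit (i + 2) (I3_neq2 i).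
have arcP k p' q' : k != i -> beyond d rho k (Z p') ->
    r * (d / 2 + rho - s) <= bary (Z q') k ->
    (p' == q') || pe_arc (A \o ye) v r X p' q'.
  move=> ki Bp le; rewrite /pe_arc; case: (eqVneq p' q') => //= _.
  apply/asboolP; rewrite !XE; exact: beyond_prox ki sd d1 Bp (Z_Te q') le.
apply: (@domination_number_le2 _ _ p q) => x.
have [k ki le] := cov x; case: (I3_cyc i k) ki le => -> ki le.
- by rewrite eqxx in ki.
- by rewrite orbA (arcP _ _ _ ki hp le).
- by rewrite orbA (arcP _ _ _ ki hq le) orbT.
Qed.

End Sample.
End Proximity.

(** * Measurability *)

Section FiniteMeasurability.
Context d (Omega : measurableType d).

Lemma measurable_const (Q : Prop) : measurable [set _ : Omega | Q].
Proof.
case: (pselect Q) => q.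
  by rewrite (_ : [set _ | _] = setT) //; apply/seteqP; split.
by rewrite (_ : [set _ | _] = set0) //; apply/seteqP; split.
Qed.

Lemma measurable_forall_fin (I : finType) (Q : I -> Omega -> Prop) :
  (forall i, measurable [set w | Q i w]) -> measurable [set w | forall i, Q i w].
Proof.
move=> mQ; rewrite (_ : [set w | _] = \bigcap_(i in setT) [set w | Q i w]).
  by apply: fin_bigcap_measurable.
by apply/seteqP; split => w /= Qw; [move=> i _|move=> i]; exact: Qw.
Qed.

Lemma measurable_exists_fin (I : finType) (Q : I -> Omega -> Prop) :
  (forall i, measurable [set w | Q i w]) -> measurable [set w | exists i, Q i w].
Proof.
move=> mQ; rewrite (_ : [set w | _] = \bigcup_(i in setT) [set w | Q i w]).
  by apply: fin_bigcup_measurable.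
by apply/seteqP; split => w /= [i]; [exists i|move=> _ ?; exists i].
Qed.

(** The event is a finite union over the possible adjacency tables [a]. *)
Lemma measurable_domination (V : finType) (arc : Omega -> rel V) (Q : nat -> Prop) :
  (forall p q, measurable [set w | arc w p q]) ->
  measurable [set w | Q (domination_number (arc w))].
Proof.
move=> marc.
rewrite (_ : [set w | _] = [set w | exists a : {ffun V * V -> bool},
   (forall pq, arc w pq.1 pq.2 = a pq) /\
   Q (domination_number (fun p q => a (p, q)))]).
  apply: measurable_exists_fin => a; apply: measurableI; last exact: measurable_const.
  apply: measurable_forall_fin => -[p q] /=; case: (a (p, q)); first exact: marc.
  rewrite (_ : [set w | _] = ~` [set w | arc w p q]); first exact: measurableC.
  by apply/seteqP; split => w /=; [move=> ->|move/negP/negbTE].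
apply/seteqP; split => w /= => [Qw|[a [aE]]].
  exists [ffun pq => arc w pq.1 pq.2]; split=> [pq|]; first by rewrite ffunE.
  rewrite (_ : (fun _ _ => _) = arc w) //.
  by apply/funext => p; apply/funext => q; rewrite ffunE.
rewrite (_ : (fun _ _ => _) = arc w) //.
by apply/funext => p; apply/funext => q; rewrite -aE.
Qed.

Lemma measurable_set_le (R : realType) (f g : Omega -> R) :
  measurable_fun setT f -> measurable_fun setT g -> measurable [set w | f w <= g w].
Proof.
move=> mf mg; have := measurable_fun_ler mf mg.
move=> /(_ measurableT [set true]); rewrite setTI; apply.
by [].
Qed.

Lemma measurable_set_eq (R : realType) (f g : Omega -> R) :
  measurable_fun setT f -> measurable_fun setT g -> measurable [set w | f w = g w].
Proof.
move=> mf mg.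
rewrite (_ : [set w | _] = [set w | f w <= g w] `&` [set w | g w <= f w]).
  by apply: measurableI; exact: measurable_set_le.
apply/seteqP; split => w /= => [->|[fg gf]]; first by split.
by apply: le_anti; rewrite fg.
Qed.

End FiniteMeasurability.

Section GammaMeasurability.
Context {R : realType} (T : set (R * R)) (A Ainv : R * R -> R * R).
Hypothesis hA : affine_chart T A Ainv.
Variables (r : R) (M : R * R) (v : R * R -> 'I_3).
Hypothesis hv : vertex_rule (A \o ye) M v.
Context d (Omega : measurableType d).

Lemma measurable_pe_gamma n (X : 'I_n -> Omega -> R * R) (Q : nat -> Prop) :
  (forall p, measurable_fun setT (X p)) ->
  measurable [set w | Q (pe_gamma (A \o ye) v r (X^~ w))].
Proof.
move=> mX; apply: measurable_domination => p q.
have mb j p' : measurable_fun setT (fun w => bary (Ainv (X p' w)) j).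
  exact: (measurableT_comp (bary_chart_measurable hA j) (mX p')).
have AK w p' : X p' w = A (Ainv (X p' w)) by case: hA => _ _ ->.
have m1 : measurable [set w | range ye (Ainv (X p w))].
  rewrite (_ : [set w | _] = [set w | exists i, forall j,
      bary (Ainv (X p w)) j = (i == j)%:R]).
    apply: measurable_exists_fin => i; apply: measurable_forall_fin => j.
    exact: measurable_set_eq.
  apply/seteqP; split => w /= => [[i _ e]|[i e]].
    by exists i => j; rewrite -e bary_ye.
  by exists i => //; apply: bary_inj => j; rewrite bary_ye e.
have m2 : measurable [set w | Ainv (X q w) = Ainv (X p w)].
  rewrite (_ : [set w | _] = [set w | forall j,
      bary (Ainv (X q w)) j = bary (Ainv (X p w)) j]).
    apply: measurable_forall_fin => j; exact: measurable_set_eq.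
  by apply/seteqP; split => w /= => [->|/bary_inj].
have m3 : measurable [set w | Te (Ainv (X q w))].
  rewrite (_ : [set w | _] = [set w | forall j, 0 <= bary (Ainv (X q w)) j]).
    apply: measurable_forall_fin => j; exact: measurable_set_le.
  by apply/seteqP; split => w /= /TeP.
have m4 : measurable [set w | `|1 - bary (Ainv (X q w)) (v (X p w))|
    <= r * `|1 - bary (Ainv (X p w)) (v (X p w))|].
  (* Splitting by the value of the label uses the measurability clause of [vertex_rule]. *)
  rewrite (_ : [set w | _] = [set w | exists k, v (X p w) = k /\
    `|1 - bary (Ainv (X q w)) k| <= r * `|1 - bary (Ainv (X p w)) k|]).
    apply: measurable_exists_fin => k; apply: measurableI.
      case: hv => _ /(_ k) mv; have := mX p measurableT _ mv.
      by rewrite setTI.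
    have mn p' : measurable_fun setT (fun w => `|1 - bary (Ainv (X p' w)) k|).
      apply: measurableT_comp; first exact: normr_measurable.
      apply: measurable_funB; [exact: measurable_cst|exact: mb].
    apply: measurable_set_le => //.
    by apply: measurable_funM; [exact: measurable_cst|exact: mn].
  apply/seteqP; split => w /= => [le|[k [<-]]//]; by exists (v (X p w)).
rewrite (_ : [set w | _] = [set w | p != q] `&`
  (([set w | range ye (Ainv (X p w))] `&` [set w | Ainv (X q w) = Ainv (X p w)]) `|`
   (~` [set w | range ye (Ainv (X p w))] `&` ([set w | Te (Ainv (X q w))] `&`
    [set w | `|1 - bary (Ainv (X q w)) (v (X p w))|
    <= r * `|1 - bary (Ainv (X p w)) (v (X p w))|])))).
  apply: measurableI; first exact: measurable_const.
  apply: measurableU; apply: measurableI => //; first exact: measurableC.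
  exact: measurableI.
apply/seteqP; split => w /=; rewrite /pe_arc /=.
  move=> /andP[pq /asboolP]; rewrite (AK w p) (AK w q).
  move/(chart_prox_region hA); rewrite -!AK => -[[a b]|[a b c]]; split => //.
    by left.
  by right; split.
case=> pq H; rewrite pq /=; apply/asboolP; rewrite (AK w p) (AK w q).
apply/(chart_prox_region hA); rewrite -!AK.
by case: H => [[a b]|[a [b c]]]; [left|right; split].
Qed.

End GammaMeasurability.

(** * Areas *)

Section Area.
Context {R : realType}.
Implicit Types (c : 'I_3 -> R) (rho : R) (D E : set (R * R)).

Definition area :=
  (@lebesgue_measure R \x @lebesgue_measure R)%E : {measure set _ -> \bar R}.

Lemma plane_measureE : plane_measure = area :> (set (R * R) -> \bar R).
Proof. by []. Qed.

Lemma area_box (a b a' b' : R) : a <= b -> a' <= b' ->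
  area (`[a, b] `*` `[a', b']) = ((b - a) * (b' - a'))%:E.
Proof.
move=> ab ab'.
transitivity (lebesgue_measure `[a, b] * lebesgue_measure `[a', b'])%E.
  by apply: product_measure1E; exact: measurable_itv.
rewrite [X in (X * _)%E](_ : _ = (b - a)%:E); last first.
  rewrite lebesgue_measure_itv /= lte_fin -EFinD; case: ltP => // ba.
  by rewrite (_ : b = a) ?subrr //; apply: le_anti; rewrite ab ba.
rewrite [X in (_ * X)%E](_ : _ = (b' - a')%:E); last first.
  rewrite lebesgue_measure_itv /= lte_fin -EFinD; case: ltP => // ba.
  by rewrite (_ : b' = a') ?subrr //; apply: le_anti; rewrite ab' ba.
by rewrite EFinM.
Qed.

Lemma chart_id : affine_chart (@Te R) id id.
Proof. by split => //; rewrite image_id. Qed.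

Lemma measurable_bary j : measurable_fun setT (fun z : R * R => bary z j).
Proof. exact: (bary_chart_measurable chart_id). Qed.

Lemma measurable_hex c rho : measurable (hex c rho).
Proof.
apply: measurable_forall_fin => j; apply: measurable_set_le => //.
apply: measurableT_comp; first exact: normr_measurable.
apply: measurable_funB => //; exact: measurable_bary.
Qed.

Lemma measurable_Te : measurable (@Te R).
Proof.
rewrite (_ : Te = [set z | forall j, 0 <= bary z j]).
  apply: measurable_forall_fin => j; apply: measurable_set_le => //.
  exact: measurable_bary.
by apply/seteqP; split => z /= /TeP.
Qed.

(** The hexagon contains an axis-parallel box of width [rho] and height [Num.sqrt 3 / 2 * rho] with
    the same center. *)
Lemma area_hex_ge c rho : 0 <= rho -> \sum_i c i = 1 ->
  ((Num.sqrt 3 / 2 * rho ^+ 2)%:E <= area (hex c rho))%E.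
Proof.
move=> r0; rewrite (sum_cyc _ 0) !add0r => c1.
set q := Num.sqrt 3; have q0 : 0 < q := sqrt3_gt0.
have -> : q / 2 * rho ^+ 2
    = ((c 1 + c 2 / 2 + rho / 2) - (c 1 + c 2 / 2 - rho / 2))
      * (q / 2 * (c 2 + rho / 2) - q / 2 * (c 2 - rho / 2)) by field.
rewrite -area_box; last 2 first.
- by lra.
- by rewrite ler_pM2l ?divr_gt0 //; lra.
apply: le_measure; rewrite ?inE; [exact: measurableX|exact: measurable_hex|].
have qd : 0 < q / 2 by rewrite divr_gt0.
move=> -[x y]; have [t ->] : exists t, y = q / 2 * t.
  by exists (y / (q / 2)); field; rewrite gt_eqF.
move=> [/=]; rewrite !in_itv /= !ler_pM2l // => /andP[x0 x1] /andP[y0 y1] j.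
have tE : q / 2 * t / q = t / 2 by field; rewrite gt_eqF.
have tE2 : 2 * (q / 2 * t) / q = t by field; rewrite gt_eqF.
rewrite ler_norml; case: (I3_cases j) => ->;
  by rewrite !baryE /= -/q ?tE ?tE2; apply/andP; split; lra.
Qed.

(** The hexagon lies in a box of width [3 * rho] and height [Num.sqrt 3 * rho]. *)
Lemma area_hex_le c rho : 0 <= rho -> \sum_i c i = 1 ->
  (area (hex c rho) <= (3 * Num.sqrt 3 * rho ^+ 2)%:E)%E.
Proof.
move=> r0; rewrite (sum_cyc _ 0) !add0r => c1.
set q := Num.sqrt 3; have q0 : 0 < q := sqrt3_gt0.
have -> : 3 * q * rho ^+ 2
    = ((c 1 + c 2 / 2 + 3 * rho / 2) - (c 1 + c 2 / 2 - 3 * rho / 2))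
      * (q / 2 * (c 2 + rho) - q / 2 * (c 2 - rho)) by field.
rewrite -area_box; last 2 first.
- by lra.
- by rewrite ler_pM2l ?divr_gt0 //; lra.
apply: le_measure; rewrite ?inE; [exact: measurable_hex|exact: measurableX|].
have qd : 0 < q / 2 by rewrite divr_gt0.
move=> -[x y]; have [t ->] : exists t, y = q / 2 * t.
  by exists (y / (q / 2)); field; rewrite gt_eqF.
have tE : q / 2 * t / q = t / 2 by field; rewrite gt_eqF.
have tE2 : 2 * (q / 2 * t) / q = t by field; rewrite gt_eqF.
move=> h; have := h 0; have := h 1; have := h 2.
rewrite !baryE /= -/q ?tE ?tE2 !ler_norml.
move=> /andP[? ?] /andP[? ?] /andP[? ?].
by split; rewrite /= in_itv /= ?ler_pM2l //; apply/andP; split; lra.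
Qed.

Definition law D E : R := fine (plane_measure (E `&` D)) / fine (plane_measure D).

Section Law.
Variable D : set (R * R).
Hypotheses (mD : measurable D) (Dfin : (area D < +oo)%E) (D0 : (0 < area D)%E).

Lemma area_fine_gt0 : 0 < fine (area D).
Proof. by rewrite fine_gt0 // D0. Qed.

Lemma areaI_fin E : measurable E -> area (E `&` D) \is a fin_num.
Proof.
move=> mE; rewrite ge0_fin_numE ?measure_ge0 //.
apply: le_lt_trans Dfin; apply: le_measure; rewrite ?inE //; first exact: measurableI.
Qed.

Lemma law_hex_ge c rho : 0 <= rho -> \sum_i c i = 1 -> hex c rho `<=` D ->
  Num.sqrt 3 / 2 * rho ^+ 2 / fine (area D) <= law D (hex c rho).
Proof.
move=> r0 c1 sub; rewrite /law plane_measureE ler_pM2r ?invr_gt0 ?area_fine_gt0 //.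
rewrite -lee_fin fineK; last by apply: areaI_fin; exact: measurable_hex.
by rewrite setIidl //; exact: area_hex_ge.
Qed.

Lemma law_hex_le c rho : 0 <= rho -> \sum_i c i = 1 ->
  law D (hex c rho) <= 3 * Num.sqrt 3 * rho ^+ 2 / fine (area D).
Proof.
move=> r0 c1; rewrite /law plane_measureE ler_pM2r ?invr_gt0 ?area_fine_gt0 //.
rewrite -lee_fin fineK; last by apply: areaI_fin; exact: measurable_hex.
apply: le_trans (area_hex_le r0 c1); apply: le_measure; rewrite ?inE.
- by apply: measurableI => //; exact: measurable_hex.
- exact: measurable_hex.
- exact: subIsetl.
Qed.

Lemma law_setU E1 E2 : measurable E1 -> measurable E2 ->
  law D (E1 `|` E2) <= law D E1 + law D E2.
Proof.
move=> m1 m2; rewrite /law plane_measureE -mulrDl.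
rewrite ler_pM2r ?invr_gt0 ?area_fine_gt0 // -lee_fin EFinD !fineK ?areaI_fin //.
  by rewrite setIUl; apply: measureU2; exact: measurableI.
exact: measurableU.
Qed.

Lemma law_setC : law D (~` D) = 0.
Proof. by rewrite /law plane_measureE setICl measure0 mul0r. Qed.

End Law.

Lemma sum_third : \sum_(i < 3) (3^-1 : R) = 1.
Proof. by rewrite sumr_const card_ord -[LHS]mulr_natl mulfV. Qed.

Lemma area_Te_lty D : measurable D -> D `<=` Te -> (area D < +oo)%E.
Proof.
move=> mD DT; apply: le_lt_trans (ltry (3 * Num.sqrt 3 * 1 ^+ 2)).
apply: le_trans (area_hex_le ler01 sum_third).
apply: le_measure; rewrite ?inE //; first exact: measurable_hex.
move=> z /DT zT j; rewrite ler_norml; have := bary_le1 j zT; move/TeP: zT => /(_ j) ? ?.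
by apply/andP; split; lra.
Qed.

Lemma area_gt0 D c rho : measurable D -> 0 < rho -> \sum_i c i = 1 ->
  hex c rho `<=` D -> (0 < area D)%E.
Proof.
move=> mD r0 c1 sub; apply: lt_le_trans (_ : ((Num.sqrt 3 / 2 * rho ^+ 2)%:E <= _)%E).
  by rewrite lte_fin !mulr_gt0 ?sqrt3_gt0 ?exprn_gt0.
apply: le_trans (area_hex_ge (ltW r0) c1) _.
by apply: le_measure; rewrite ?inE //; exact: measurable_hex.
Qed.

Lemma vertex_dist_ye i (z : R * R) :
  vertex_dist ye i z = Num.sqrt 3 / 2 * `|1 - bary z i|.
Proof.
have n1 : (ye (i + 2) - ye (i + 1)).1 ^+ 2 + (ye (i + 2) - ye (i + 1)).2 ^+ 2 = 1 :> R.
  have E a b : (a == b :> 'I_3) -> ye a = ye b :> R * R by move/eqP->.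
  case: (I3_cases i) => ->.
  - rewrite (E (0 + 2) 2) // (E (0 + 1) 1) // ye1 ye2 /=.
    by rewrite subr0 expr_div_n sqr_sqrt3; field.
  - rewrite (E (1 + 2) 0) // (E (1 + 1) 2) // ye0 ye2 /=.
    by rewrite !sub0r !sqrrN expr_div_n sqr_sqrt3; field.
  - rewrite (E (2 + 2) 1) // (E (2 + 1) 0) // ye0 ye1 /=.
    by rewrite !subr0 expr1n expr0n addr0.
rewrite /vertex_dist /parallel_line edist_line.
  rewrite n1 sqrtr1 divr1 cross_ye normrN normrM.
  by rewrite ger0_norm // divr_ge0 ?sqrtr_ge0.
by apply/eqP => e0; move: n1; rewrite e0 /= expr0n addr0 => /eqP; rewrite eq_sym oner_eq0.
Qed.

(** The height of [Te] is [Num.sqrt 3 / 2], so distance [e] from a vertex costs [2 * e / Num.sqrt 3]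
    in its coordinate. *)
Lemma corners_bary (e : R) z : corners e z <->
  Te z /\ exists j, 1 - bary z j <= 2 * e / Num.sqrt 3.
Proof.
have E j : Te z -> (vertex_dist ye j z <= e) = (1 - bary z j <= 2 * e / Num.sqrt 3).
  move=> zT; rewrite vertex_dist_ye ger0_norm ?subr_ge0 ?bary_le1 //.
  rewrite ler_pdivlMr ?sqrt3_gt0 //.
  by apply/idP/idP; lra.
split=> [[j _ [zT zj]]|[zT [j zj]]]; first by split=> //; exists j; rewrite -E.
by exists j => //; split => //; rewrite E.
Qed.

Lemma measurable_corners (e : R) : measurable (corners e).
Proof.
rewrite (_ : corners e = Te `&` [set z | exists j, 1 - bary z j <= 2 * e / Num.sqrt 3]).
  apply: measurableI; first exact: measurable_Te.
  apply: measurable_exists_fin => j; apply: measurable_set_le => //.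
  by apply: measurable_funB => //; exact: measurable_bary.
by apply/seteqP; split => z /= /corners_bary.
Qed.

End Area.

(** * Hitting and avoiding sets *)

Section ProductBounds.
Context {R : realType} (I : finType).
Implicit Types (a b : I -> R).

(** Weierstrass's product inequality. *)
Lemma prod1D_ge a : (forall i, 0 <= a i) -> 1 + \sum_i a i <= \prod_i (1 + a i).
Proof.
move=> a0; elim: (index_enum I) => [|i l IH]; first by rewrite !big_nil addr0.
rewrite !big_cons; have s0 : 0 <= \sum_(j <- l) a j by exact: sumr_ge0.
have : (1 + a i) * (1 + \sum_(j <- l) a j) <= (1 + a i) * \prod_(j <- l) (1 + a j).
  by rewrite ler_wpM2l // addr_ge0.
have := mulr_ge0 (a0 i) s0; lra.
Qed.

(** Multiply by the product of the [1 + a i]: each factor [(1 - a i) * (1 + a i)] is at most 1, and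
    [prod1D_ge] applies. *)
Lemma prod1B_le a : (forall i, 0 <= a i <= 1) ->
  \prod_i (1 - a i) <= (1 + \sum_i a i)^-1.
Proof.
move=> a01.
have a0 i : 0 <= a i by case/andP: (a01 i).
have s0 : 0 < 1 + \sum_i a i by rewrite ltr_pwDl // sumr_ge0.
have p0 : 0 <= \prod_i (1 - a i).
  by apply: prodr_ge0 => i _; rewrite subr_ge0; case/andP: (a01 i).
rewrite -[leRHS]mul1r ler_pdivlMr //.
apply: le_trans (ler_wpM2l p0 (prod1D_ge a0)) _.
rewrite -big_split /=; apply: prodr_ile1 => i _; case/andP: (a01 i) => ai0 ai1.
have h : 0 <= (1 - a i) * (1 + a i) by rewrite mulr_ge0 ?subr_ge0 // addr_ge0.
by rewrite h /=; have := mulr_ge0 ai0 ai0; lra.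
Qed.

(** Factor by factor: [expR (2 * b) >= 1 + 2 * b], and [(1 - b) * (1 + 2 * b) >= 1] on
    [[0, 1/2]]. *)
Lemma prod1B_ge b : (forall i, 0 <= b i <= 1 / 2) ->
  expR (- (2 * \sum_i b i)) <= \prod_i (1 - b i).
Proof.
move=> b01; rewrite mulr_sumr -sumrN expR_sum; apply: ler_prod => i _.
rewrite expR_ge0 /= expRN; case/andP: (b01 i) => b0 b1.
apply: le_trans (_ : (1 + 2 * b i)^-1 <= _).
  by rewrite lef_pV2 ?posrE ?expR_gt0 ?expR_ge1Dx //; lra.
rewrite -[leLHS]mul1r ler_pdivrMr; last by lra.
have := mulr_ge0 b0 (_ : 0 <= 1 - 2 * b i); lra.
Qed.

End ProductBounds.

Section HitAndAvoid.
Context {R : realType} d (Omega : measurableType d) (P : probability Omega R).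
Variables (I T : finType) (X : I -> {RV P >-> (R * R)%type}).
Hypothesis X_indep : mutually_independent X.

Definition prob_in i (E : set (R * R)) : R := fine (P (X i @^-1` E)).

Definition avoid (E : I -> set (R * R)) := [set w | forall i, ~ E i (X i w)].

Lemma measurable_RV_preimage i (E : set (R * R)) :
  measurable E -> measurable (X i @^-1` E).
Proof. by move=> mE; rewrite -[X in measurable X]setTI; exact: measurable_funP. Qed.

Lemma prob_inE i (E : set (R * R)) : measurable E -> P (X i @^-1` E) = (prob_in i E)%:E.
Proof. by move=> mE; rewrite /prob_in fineK // fin_num_measure //; exact: measurable_RV_preimage. Qed.

Lemma prob_in_ge0 i (E : set (R * R)) : 0 <= prob_in i E.
Proof. by rewrite /prob_in fine_ge0. Qed.

Lemma prob_in_le1 i (E : set (R * R)) : measurable E -> prob_in i E <= 1.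
Proof.
by move=> mE; rewrite -lee_fin -prob_inE // probability_le1 //; exact: measurable_RV_preimage.
Qed.

Lemma measurable_avoid E : (forall i, measurable (E i)) -> measurable (avoid E).
Proof.
move=> mE; apply: measurable_forall_fin => i; apply: measurableC.
exact: measurable_RV_preimage.
Qed.

Lemma probability_avoid E : (forall i, measurable (E i)) ->
  P (avoid E) = (\prod_i (1 - prob_in i (E i)))%:E.
Proof.
move=> mE; rewrite (_ : avoid E = \bigcap_(i in setT) (X i @^-1` (~` E i))).
  rewrite X_indep; last by move=> i; exact: measurableC.
  rewrite -prodEFin; apply: eq_bigr => i _.
  rewrite preimage_setC probability_setC ?prob_inE //.
  exact: measurable_RV_preimage.
by apply/seteqP; split => w /= H; [move=> i _|move=> i]; exact: H.
Qed.

Lemma probability_fin_union (B : T -> set Omega) : (forall h, measurable (B h)) ->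
  (P [set w | exists h, B h w] <= \sum_h P (B h))%E.
Proof.
move=> mB.
suff : forall l : seq T, (P [set w | exists2 h, h \in l & B h w] <= \sum_(h <- l) P (B h))%E.
  move=> /(_ (index_enum T)); apply: le_trans.
  rewrite (_ : [set w | exists h, B h w] = [set w | exists2 h, h \in index_enum T & B h w]) //.
  by apply/seteqP; split => w /= [h]; exists h => //; rewrite mem_index_enum.
elim=> [|h l IH].
  rewrite big_nil (_ : [set w | _] = set0) ?measure0 //.
  by apply/seteqP; split => w // [].
rewrite big_cons (_ : [set w | _] = B h `|` [set w | exists2 h, h \in l & B h w]).
  apply: le_trans (leeD2l _ IH); apply: measureU2 => //.
  elim: (l) => [|k l' ml'].
    rewrite (_ : [set w | _] = set0) //.
    by apply/seteqP; split => w // [].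
  rewrite (_ : [set w | _] = B k `|` [set w | exists2 h, h \in l' & B h w]).
    exact: measurableU.
  apply/seteqP; split => w /=; first by move=> [j]; rewrite inE => /predU1P[->|jl]; [left|right; exists j].
  by case=> [Bk|[j jl Bj]]; [exists k|exists j]; rewrite ?inE ?eqxx ?jl ?orbT.
apply/seteqP; split => w /=; first by move=> [j]; rewrite inE => /predU1P[->|jl]; [left|right; exists j].
by case=> [Bk|[j jl Bj]]; [exists h|exists j]; rewrite ?inE ?eqxx ?jl ?orbT.
Qed.

Variables (S : I -> set (R * R)) (A : T -> I -> set (R * R)).
Hypotheses (mS : forall i, measurable (S i)) (mA : forall h i, measurable (A h i)).
Hypothesis SA : forall h i, S i `&` A h i = set0.

Definition hit_avoid :=
  [set w | (forall i, ~ S i (X i w)) /\ forall h, exists i, A h i (X i w)].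

Lemma measurable_hit_avoid : measurable hit_avoid.
Proof.
apply: measurableI; first exact: measurable_avoid.
apply: measurable_forall_fin => h; apply: measurable_exists_fin => i.
exact: measurable_RV_preimage.
Qed.

(** By disjointness each factor is [1 - s - a <= (1 - s) * (1 - a)]; the product of the [1 - a] is
    bounded by [prod1B_le]. *)
Lemma probability_avoid_both h :
  (P (avoid (fun i => S i `|` A h i)) <=
   (\prod_i (1 - prob_in i (S i)) * (1 + \sum_i prob_in i (A h i))^-1)%:E)%E.
Proof.
rewrite probability_avoid; last by move=> i; exact: measurableU.
have prob_inU i : prob_in i (S i `|` A h i) = prob_in i (S i) + prob_in i (A h i).
  apply: EFin_inj; rewrite EFinD -!prob_inE //; last exact: measurableU.
  rewrite preimage_setU measureU //; try exact: measurable_RV_preimage.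
  by rewrite -preimage_setI SA preimage_set0.
rewrite lee_fin; apply: le_trans (_ : \prod_i (1 - prob_in i (S i)) * \prod_i (1 - prob_in i (A h i)) <= _).
  rewrite -big_split /=; apply: ler_prod => i _.
  have := prob_in_le1 i (measurableU _ _ (mS i) (mA h i)); rewrite prob_inU => le1.
  by have := mulr_ge0 (prob_in_ge0 i (S i)) (prob_in_ge0 i (A h i)); lra.
apply: ler_wpM2l.
  by apply: prodr_ge0 => i _; rewrite subr_ge0 prob_in_le1.
by apply: prod1B_le => i; rewrite prob_in_ge0 prob_in_le1.
Qed.

(* Union bound over the targets that are missed: by [prod1B_le] missing the target
   [h] costs a factor at most [1 / (1 + 2 #|T|)]. *)
Lemma probability_hit_avoid (B : R) :
  (forall i, prob_in i (S i) <= 1 / 2) -> \sum_i prob_in i (S i) <= B ->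
  (forall h, 2 * #|T|%:R <= \sum_i prob_in i (A h i)) ->
  ((expR (- (2 * B)) / 2)%:E <= P hit_avoid)%E.
Proof.
move=> S12 SB Ah; set p := \prod_i (1 - prob_in i (S i)).
have pe : expR (- (2 * B)) <= p.
  apply: le_trans (prod1B_ge _); last by move=> i; rewrite prob_in_ge0 S12.
  by rewrite ler_expR; lra.
have mavoid h : measurable (avoid (fun i => S i `|` A h i)).
  by apply: measurable_avoid => i; exact: measurableU.
have sub : (P (avoid S) <= P hit_avoid +
    \sum_h P (avoid (fun i => S i `|` A h i)))%E.
  apply: le_trans (leeD2l _ (probability_fin_union mavoid)).
  apply: le_trans (measureU2 _ measurable_hit_avoid _); last first.
    exact: measurable_exists_fin.
  apply: le_measure; rewrite ?inE.
  - exact: measurable_avoid.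
  - apply: measurableU; first exact: measurable_hit_avoid.
    exact: measurable_exists_fin.
  - move=> w Sw; have [hit|] := pselect (forall h, exists i, A h i (X i w)).
      by left; split.
    move=> /existsNP[h nh]; right; exists h => i [|Ai]; first exact: Sw.
    by apply: nh; exists i.
(* Since [#|T| / (1 + 2 #|T|) <= 1 / 2], missed targets use up at most half of the probability [p]
   of avoiding [S]. *)
have hb : (\sum_h P (avoid (fun i => S i `|` A h i)) <= (p / 2)%:E)%E.
  apply: le_trans (_ : (\sum_(h : T) (p * (1 + 2 * #|T|%:R)^-1)%:E <= _)%E).
    apply: lee_sum => h _; apply: le_trans (probability_avoid_both h) _.
    rewrite lee_fin ler_wpM2l ?(le_trans _ pe) ?expR_ge0 //.
    rewrite lef_pV2 ?posrE; [by rewrite lerD2l Ah| |].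
      by rewrite ltr_pwDl // sumr_ge0 // => i _; exact: prob_in_ge0.
    by rewrite ltr_pwDl // mulr_ge0.
  rewrite sumEFin lee_fin sumr_const -[X in X <= _]mulr_natl mulrCA ler_wpM2l ?(le_trans _ pe) ?expR_ge0 //.
  by rewrite ler_pdivrMr ?ltr_pwDl ?mulr_ge0 //; have := ler0n R #|T|; lra.
move: sub; rewrite probability_avoid // -/p => sub.
have : ((p / 2)%:E <= P hit_avoid)%E.
  rewrite (_ : p / 2 = p - p / 2); last by field.
  rewrite EFinB leeBlDr //; apply: le_trans sub _.
  exact: leeD2l.
by apply: le_trans; rewrite lee_fin ler_pM2r.
Qed.

End HitAndAvoid.

(** * Configurations that decide the domination number *)

Section Schemes.
Context {R : realType}.
Variables (r : R) (i : 'I_3).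
Hypothesis hr : 1 < r <= 3 / 2.
Let M := special_point r i.
Let s := (r - 1) / r.
Implicit Types (D : set (R * R)) (j k : 'I_3) (a b u d rho : R).

(** Targets are indexed by a vertex and a flag; a configuration with fewer targets repeats some.
    Quantifying over charts and rules lets one configuration serve every triangle. *)
Definition forces D (S : set (R * R)) (H : 'I_3 * bool -> set (R * R))
    (n : nat) (Q : nat -> Prop) :=
  forall T (A Ainv : R * R -> R * R) v, affine_chart T A Ainv ->
  vertex_rule (A \o ye) (A M) v -> forall X : 'I_n -> R * R,
  (forall p, ~ S (Ainv (X p))) -> (forall h, exists p, H h (Ainv (X p))) ->
  Q (pe_gamma (A \o ye) v r X).

(* For [n] points uniform on [D], the expected number of points in [S] stays
   bounded while that in each [H h] can be made as large as wanted. *)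
Definition scheme D (Q : nat -> Prop) := forall a, 0 < a ->
  exists b n0, forall n : nat, (n0 <= n)%N -> (0 < n)%N ->
  exists S H, [/\ measurable S /\ (forall h, measurable (H h)),
    forall h, S `&` H h = set0, law D S <= b / n%:R,
    forall h, a / n%:R <= law D (H h) & forces D S H n Q].

(* Center of a hexagon of size [u] inside the triangle, close to [y_k]. *)
Definition near_center k u j : R := if j == k then 1 - u else u / 2.

Lemma sum_near_center k u : \sum_j near_center k u j = 1.
Proof. by rewrite (sum_cyc _ k) /near_center !I3_eqs; lra. Qed.

Lemma hex_near_center k u x : 0 < u <= 1 / 2 -> hex (near_center k u) (u / 4) x ->
  [/\ Te x, 1 - bary x k <= 5 / 4 * u
     & forall j, j != k -> u / 4 <= bary x j <= 3 / 4 * u].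
Proof.
move=> /andP[u0 u1] hx.
have hk : 1 - 5 / 4 * u <= bary x k.
  by have := hx k; rewrite /near_center eqxx ler_norml => /andP[? ?]; lra.
have hj j : j != k -> u / 4 <= bary x j <= 3 / 4 * u.
  move=> jk; have := hx j; rewrite /near_center (negbTE jk) ler_norml.
  by move=> /andP[? ?]; apply/andP; split; lra.
split => //; last by lra.
by apply/TeP => j; case: (eqVneq j k) => [->|/hj/andP[? ?]]; lra.
Qed.

(* Center of a hexagon contained in [beyond i d rho k]. *)
Definition beyond_center d rho k j : R :=
  if j == i then 1 - d - rho / 4 else if j == k then d / 2 + rho / 2
  else d / 2 - rho / 4.

Lemma sum_beyond_center d rho k : k != i -> \sum_j beyond_center d rho k j = 1.
Proof.
by rewrite (sum_cyc _ i) /beyond_center; case: (I3_cyc i k) => ->; rewrite !I3_eqs //; lra.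
Qed.

Lemma hex_beyond_center d rho k x : k != i -> 0 < rho -> rho <= d ->
  d + rho <= 1 -> hex (beyond_center d rho k) (rho / 16) x ->
  beyond i d rho k x /\ d / 2 + 7 / 16 * rho <= bary x k <= d / 2 + 9 / 16 * rho.
Proof.
move=> ki r0 rd d1 hx.
have hi : 1 - d - 5 / 16 * rho <= bary x i <= 1 - d - 3 / 16 * rho.
  by have := hx i; rewrite /beyond_center eqxx ler_norml => /andP[? ?]; apply/andP; split; lra.
have hk : d / 2 + 7 / 16 * rho <= bary x k <= d / 2 + 9 / 16 * rho.
  have := hx k; rewrite /beyond_center eqxx (negbTE ki) ler_norml.
  by move=> /andP[? ?]; apply/andP; split; lra.
have ho j : j != i -> j != k -> d / 2 - 5 / 16 * rho <= bary x j <= d / 2 - 3 / 16 * rho.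
  move=> ji jk; have := hx j; rewrite /beyond_center (negbTE ji) (negbTE jk) ler_norml.
  by move=> /andP[? ?]; apply/andP; split; lra.
case/andP: (hi) => hi1 hi2; case/andP: (hk) => hk1 hk2.
split; last exact: hk; split.
- apply/TeP => j; case: (eqVneq j i) => [->|ji]; first lra.
  case: (eqVneq j k) => [->|jk]; first lra.
  by have /andP[] := ho j ji jk; lra.
- lra.
- by move=> j ji jk; have /andP[] := ho j ji jk; lra.
- by apply/andP; split; lra.
Qed.

Lemma inv_sqrt_small (kappa eta : R) : 0 < kappa -> 0 < eta ->
  exists n0, forall n : nat, (n0 <= n)%N -> (0 < n)%N ->
    0 < kappa / Num.sqrt n%:R <= eta.
Proof.
move=> k0 e0; exists (Num.bound ((kappa / eta) ^+ 2)) => n hn n0.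
have n0' : 0 < Num.sqrt n%:R :> R by rewrite sqrtr_gt0 ltr0n.
rewrite divr_gt0 //= ler_pdivrMr // mulrC -ler_pdivrMr //.
rewrite -[leLHS]ger0_norm ?divr_ge0 ?(ltW k0) ?(ltW e0) // -sqrtr_sqr ler_sqrt ?ler0n //.
apply: ltW; apply: lt_le_trans (archi_boundP _) _; first exact: sqr_ge0.
by rewrite ler_nat.
Qed.

Lemma sqr_div_sqrt (kappa : R) (n : nat) :
  (kappa / Num.sqrt n%:R) ^+ 2 = kappa ^+ 2 / n%:R.
Proof. by rewrite expr_div_n sqr_sqrtr. Qed.

Section Support.
Variable D : set (R * R).
Hypotheses (mD : measurable D) (DT : D `<=` Te) (D0 : (0 < area D)%E).
Let Dfin : (area D < +oo)%E. Proof. exact: area_Te_lty. Qed.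
Let V := fine (area D).
Let V0 : 0 < V. Proof. exact: area_fine_gt0. Qed.

(** A hexagon of radius of order [kappa / Num.sqrt n] has probability of order [kappa ^+ 2 / n], so
    a large [kappa] beats any [a]. The divisor 16 accommodates the smallest targets used below. *)
Lemma scale_exists a : 0 < a -> exists2 kappa, 0 < kappa &
  forall (n : nat) c rho, (0 < n)%N -> kappa / Num.sqrt n%:R / 16 <= rho ->
    \sum_i c i = 1 -> hex c rho `<=` D -> a / n%:R <= law D (hex c rho).
Proof.
move=> a0; have q0 := @sqrt3_gt0 R.
pose X := 2 * 16 ^+ 2 * a * V / Num.sqrt 3.
have X0 : 0 < X by rewrite divr_gt0 // mulr_gt0 // mulr_gt0 // mulr_gt0 // exprn_gt0.
(* The bound needs [kappa ^+ 2 >= X]; [1 + X] achieves it without a square root. *)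
exists (1 + X); first by lra.
move=> n c rho n0; set u := _ / Num.sqrt _ => urho c1 sub.
have u0 : 0 < u by rewrite divr_gt0 ?sqrtr_gt0 ?ltr0n //; lra.
have rho0 : 0 <= rho by apply: le_trans urho; rewrite divr_ge0 // ltW.
apply: le_trans (law_hex_ge mD Dfin D0 rho0 c1 sub).
apply: le_trans (_ : Num.sqrt 3 / 2 * (u / 16) ^+ 2 / V <= _); last first.
  rewrite ler_pM2r ?invr_gt0 // ler_pM2l ?divr_gt0 //.
  by apply: lerXn2r => //; rewrite nnegrE // divr_ge0 // ltW.
rewrite expr_div_n sqr_div_sqrt.
have -> : a / n%:R = Num.sqrt 3 / 2 * (X / n%:R / 16 ^+ 2) / V.
  by rewrite /X; field; rewrite !gt_eqF ?ltr0n.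
rewrite ler_pM2r ?invr_gt0 // ler_pM2l ?divr_gt0 // !ler_pM2r ?invr_gt0 ?ltr0n //.
by have := sqr_ge0 X; lra.
Qed.

Lemma law_setC_hex c rho : 0 <= rho -> \sum_i c i = 1 ->
  law D (~` D `|` hex c rho) <= 3 * Num.sqrt 3 * rho ^+ 2 / V.
Proof.
move=> r0 c1; apply: le_trans (law_setU mD Dfin D0 _ _) _.
- exact: measurableC.
- exact: measurable_hex.
- by rewrite law_setC add0r; exact: law_hex_le.
Qed.

Lemma sum_bary_M : \sum_i bary M i = 1. Proof. exact: sum_bary. Qed.

Lemma scheme_ge3 (eta : R) : 0 < eta ->
  (forall x k, Te x -> 1 - bary x k <= eta -> D x) ->
  scheme D (fun g => 3 <= g)%N.
Proof.
have [r0 s0 s3 rs] := ratio_bounds hr; rewrite -/s in s0 s3 rs.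
move=> eta0 wide a a0; have [kappa k0 hit] := scale_exists a0.
(* The first bound on [u] keeps the targets inside [D]; the second makes [u / s] small against [s],
   separating them from the hexagon at [M]. *)
have e'0 : 0 < Num.min (eta / 2) (s ^+ 2 / 100).
  by rewrite lt_min !divr_gt0 // exprn_gt0.
have [n0 small] := inv_sqrt_small k0 e'0.
(* [area_hex_le] at radius [2 * u / s], with [u ^+ 2 = kappa ^+ 2 / n]. *)
exists (12 * Num.sqrt 3 * kappa ^+ 2 / s ^+ 2 / V), n0 => n nn0 n_gt0.
have /andP[u0] := small n nn0 n_gt0; set u := kappa / _ in u0 *.
rewrite le_min => /andP[ueta us2].
pose t := u / s; have ts : u = s * t by rewrite /t; field; rewrite gt_eqF.
have t0 : 0 < t by rewrite divr_gt0.
have t1 : t <= s / 100.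
  by rewrite /t ler_pdivrMr // mulrAC -expr2.
have ut : u <= t by rewrite ts ler_piMl ?(ltW t0) //; lra.
have u12 : 0 < u <= 1 / 2 by rewrite u0 /=; lra.
have nearD k x : hex (near_center k u) (u / 4) x -> D x.
  by move=> /(hex_near_center u12)[xT xk _]; apply: (wide x k xT); lra.
exists (~` D `|` hex (bary M) (2 * u / s)), (fun h => hex (near_center h.1 u) (u / 4)).
split.
- split=> [|h]; last exact: measurable_hex.
  by apply: measurableU; [exact: measurableC|exact: measurable_hex].
- move=> [k b]; apply/seteqP; split => x //= [[nDx|hx] kx].
    by apply: nDx; exact: nearD kx.
  have [_ _ /(_ (k + 1))] := hex_near_center u12 kx.
  rewrite I3_neq1 => /(_ isT) /andP[_ xj]; have := hx (k + 1).
  have := bary_M_ge i hr (k + 1); rewrite -/s -/M ler_norml -mulrA -/t => ? /andP[? _].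
  lra.
- apply: le_trans (law_setC_hex _ sum_bary_M) _.
    by rewrite -mulrA mulr_ge0 // ltW.
  rewrite -[leRHS](_ : 3 * Num.sqrt 3 * (2 * u / s) ^+ 2 / V = _) //.
  rewrite expr_div_n exprMn /u sqr_div_sqrt.
  by field; rewrite !gt_eqF ?ltr0n.
- move=> [k b]; apply: hit => //=; first by rewrite -/u; lra.
  - exact: sum_near_center.
  - by move=> x; exact: nearD.
- move=> T A Ainv v hA hv X avoidS hitH.
  have XD p : D (Ainv (X p)).
    by apply: contrapT => nD; apply: (avoidS p); left.
  apply: (@pe_gamma_ge3 R T A Ainv hA r i v hr hv n X _ u u0); rewrite -/s -/M.
  + by move=> p; exact/DT.
  + by move=> p hp; apply: (avoidS p); right.
  + move=> k; have [p hp] := hitH (k, true); exists p => j jk.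
    have [_ _ /(_ j jk) /andP[b1 b2]] := hex_near_center u12 hp.
    by apply/andP; split; lra.
Qed.

(** The points that two well placed sample points fail to reach lie in the removed corner at [y_i].
    The targets can therefore have a fixed size, independent of [n]. *)
Lemma scheme_le2 (delta : R) : 0 < delta < 2 / 3 ->
  (forall x, D x <-> Te x /\ forall j, delta < 1 - bary x j) ->
  scheme D (fun g => g <= 2)%N.
Proof.
have [r0 s0 s3 rs] := ratio_bounds hr; rewrite -/s in s0 s3 rs.
have /andP[r1 r32] := hr.
move=> /andP[d0 d23] DE a a0; have [kappa k0 hit] := scale_exists a0.
(* The point with coordinate [1 - d] at [y_i] is [M] if [M] is in the support, and
   otherwise the point where the median from [y_i] enters the support. *)
pose d := Num.max delta (2 * s).
have dd : delta <= d by rewrite le_max lexx.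
have sd : 2 * s <= d by rewrite le_max lexx orbT.
have d_le : d <= 2 / 3 by rewrite ge_max ltW //=; lra.
(* The bounds [delta / 3] and [(r - 1) / 3] serve the two cases of [cover]; [2 / 3 - delta] keeps
   the targets inside [D]. *)
pose rho := Num.min (Num.min (delta / 3) ((r - 1) / 3)) (2 / 3 - delta).
have rho0 : 0 < rho by rewrite !lt_min; apply/andP; split; [apply/andP; split|]; lra.
have : rho <= rho by [].
rewrite {2}/rho !le_min => /andP[/andP[rho1 rho2] rho3].
(* If both coordinates other than [i] were below [r * (d / 2 + rho - s)], this would force the
   coordinate at [y_i] above [1 - delta], into the removed corner. *)
have cover : r * (d - 2 * s) + 2 * (r * rho) <= delta.
  have h1 : r * rho <= 3 / 2 * rho by rewrite ler_pM2r.
  have rsE : r * s = r - 1 by lra.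
  rewrite /d; case: (leP delta (2 * s)) => h; first by rewrite subrr mulr0 add0r; lra.
  have : (r - 1) * (2 - delta) >= (r - 1) * (4 / 3) by rewrite ler_pM2l; lra.
  by lra.
have hexD k x : k != i -> hex (beyond_center d rho k) (rho / 16) x -> D x.
  move=> ki /(hex_beyond_center ki rho0); case; [by lra|by lra|].
  move=> [xT xi xo _] /andP[xk1 xk2]; apply/DE; split => // j.
  have [k' [k'i k'k kc]] := I3_other ki.
  by have := xo k' k'i k'k; case: (kc j) => ->; lra.
have [n0 small] := inv_sqrt_small k0 rho0.
pose other k := if k == i then i + 1 else k.
have otherN k : other k != i by rewrite /other; case: (eqVneq k i) => // _; rewrite I3_neq1.
(* Only the complement of the support is avoided, an event of probability 0, hence [b = 0]. *)
exists 0, n0 => n nn0 n_gt0; have /andP[u0 urho] := small n nn0 n_gt0.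
exists (~` D), (fun h => hex (beyond_center d rho (other h.1)) (rho / 16)).
split.
- by split=> [|h]; [exact: measurableC|exact: measurable_hex].
- move=> [k b]; apply/seteqP; split => x //= [nDx hx].
  by apply: nDx; exact: hexD hx.
- by rewrite law_setC mul0r.
- move=> [k b]; apply: hit => //=; first by rewrite ler_pM2r.
  - exact: sum_beyond_center.
  - by move=> x; exact: hexD.
- move=> T A Ainv v hA hv X avoidS hitH.
  have XD p : D (Ainv (X p)) by apply: contrapT => nD; exact: (avoidS p).
  apply: (@pe_gamma_le2 R T A Ainv hA r i v hr hv n X _ d rho) => //.
  + by move=> p; exact/DT.
  + by lra.
  + move=> k ki; have [p hp] := hitH (k, true); exists p.
    move: hp; rewrite /= /other (negbTE ki) => /(hex_beyond_center ki rho0) [| |//]; lra.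
  + move=> q; have [xT xb] := (DE _).1 (XD q); rewrite -/s.
    apply: contrapT => /forall2NP h.
    have lt k : k != i -> bary (Ainv (X q)) k < r * (d / 2 + rho - s).
      by move=> ki; have [|/negP] := h k => //; rewrite -ltNge.
    have := lt _ (I3_neq1 i); have := lt _ (I3_neq2 i).
    have := bary_cyc (Ainv (X q)) i; have := xb i; lra.
Qed.

End Support.

(** Both bounds at once: emptiness near [M] and hits at two vertices give [gamma >= 2]; hits just
    beyond [M] and emptiness near [y_i] give [gamma <= 2]. *)
Lemma scheme_eq2 : (0 < area (@Te R))%E -> scheme Te (fun g => g = 2%N).
Proof.
have [r0 s0 s3 rs] := ratio_bounds hr; rewrite -/s in s0 s3 rs.
have /andP[r1 r32] := hr.
move=> T0 a a0; have TT := @subset_refl _ (@Te R).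
have Tfin := area_Te_lty (@measurable_Te R) TT.
have [kappa k0 hit] := scale_exists (@measurable_Te R) TT T0 a0.
have e'0 : 0 < s ^+ 2 / 100 by rewrite divr_gt0 // exprn_gt0.
have [n0 small] := inv_sqrt_small k0 e'0.
(* The two terms come from the hexagons of radii [2 * u / s] and [2 * (r * w) = 16 * r * u / s]. *)
exists (3 * Num.sqrt 3 * kappa ^+ 2 * (4 / s ^+ 2 + (16 * r / s) ^+ 2) / fine (area (@Te R))), n0.
move=> n nn0 n_gt0.
have /andP[u0] := small n nn0 n_gt0; set u := kappa / _ in u0 * => us2.
pose t := u / s; have ts : u = s * t by rewrite /t; field; rewrite gt_eqF.
have t0 : 0 < t by rewrite divr_gt0.
have t1 : t <= s / 100 by rewrite /t ler_pdivrMr // mulrAC -expr2.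
have ut : u <= t by rewrite ts ler_piMl ?(ltW t0) //; lra.
have u12 : 0 < u <= 1 / 2 by rewrite u0 /=; lra.
(* The targets beyond [M] have [k]-th coordinate at least [s + 7 / 16 * w = s + 7 / 2 * t], outside
   the hexagon of radius [2 * t] at [M]. *)
pose w := 8 * t; have w0 : 0 < w by rewrite mulr_gt0.
have rw : r * w <= 12 * t by rewrite /w mulrCA (_ : 12 = 8 * (3 / 2)); [rewrite -mulrA ler_pM2l // ler_pM2r|field].
pose other k := if k == i then i + 1 else k.
have otherN k : other k != i by rewrite /other; case: (eqVneq k i) => // _; rewrite I3_neq1.
(* A point reached by neither chosen point has both coordinates other than [i] below [r * w], so it
   is within [2 * (r * w)] of [y_i]. *)
pose S := ~` Te `|` hex (bary M) (2 * u / s) `|` hex (bary (ye i)) (2 * (r * w)).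
pose H (h : 'I_3 * bool) := if h.2 then hex (near_center (other h.1) u) (u / 4)
  else hex (beyond_center (2 * s) w (other h.1)) (w / 16).
have far k x : k != i -> hex (beyond_center (2 * s) w k) (w / 16) x ->
    beyond i (2 * s) w k x /\ s + 7 / 16 * w <= bary x k.
  move=> ki /(hex_beyond_center ki w0) [| |B /andP[h _]]; rewrite /w; [lra|lra|].
  by split => //; move: h; rewrite /w; lra.
have SH h : S `&` H h = set0.
  apply/seteqP; split => x //=; case: h => k b; rewrite /S /H /=.
  have ki := otherN k; case: b => -[[[nT|hM]|hi] hx].
  - by apply: nT; have [] := hex_near_center u12 hx.
  - have [j /andP[jk _]] := I3_avoid2 (other k) (other k).
    have [_ _ /(_ j jk) /andP[_ xj]] := hex_near_center u12 hx.
    have := hM j; have := bary_M_ge i hr j; rewrite -/s -/M ler_norml -mulrA -/t => ? /andP[? _].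
    lra.
  - have [_ _ /(_ i)] := hex_near_center u12 hx; rewrite eq_sym ki => /(_ isT) /andP[_ xi].
    by have := hi i; rewrite bary_ye eqxx /= ler_norml => /andP[? _]; lra.
  - by apply: nT; have [[]] := far _ _ ki hx.
  - have [_] := far _ _ ki hx; have := hM (other k).
    rewrite /M (bary_M i hr) -/s (negbTE ki) ler_norml -mulrA -/t /w => /andP[_ ?]; lra.
  - have [[_ xi _ _] _] := far _ _ ki hx; have := hi i.
    by rewrite bary_ye eqxx /= ler_norml => /andP[? _]; lra.
exists S, H; split => //.
- split=> [|h]; last by rewrite /H; case: ifP => _; exact: measurable_hex.
  apply: measurableU; last exact: measurable_hex.
  by apply: measurableU; [apply: measurableC; exact: measurable_Te|exact: measurable_hex].
- apply: le_trans (law_setU (@measurable_Te R) Tfin T0 _ (@measurable_hex R _ _)) _.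
    by apply: measurableU; [apply: measurableC; exact: measurable_Te|exact: measurable_hex].
  apply: le_trans (lerD (law_setC_hex (@measurable_Te R) TT T0 _ sum_bary_M)
    (law_hex_le (@measurable_Te R) Tfin T0 _ (sum_bary (ye i)))) _.
  + by rewrite -mulrA mulr_ge0 // ltW.
  + by rewrite mulr_ge0 // mulr_ge0 // ltW.
  + rewrite [leLHS](_ : _ = 3 * Num.sqrt 3 * u ^+ 2 * (4 / s ^+ 2 + (16 * r / s) ^+ 2) / fine (area (@Te R))).
      rewrite /u sqr_div_sqrt.
      rewrite le_eqVlt; apply/orP; left; apply/eqP; field.
      by rewrite !gt_eqF ?ltr0n // area_fine_gt0.
    rewrite /w /t; field.
    by rewrite !gt_eqF // area_fine_gt0.
- move=> [k b]; have ki := otherN k.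
  rewrite /H /=; case: b; apply: hit => //; rewrite -/u.
  + lra.
  + exact: sum_near_center.
  + by move=> x /(hex_near_center u12) [].
  + by rewrite /w; lra.
  + exact: sum_beyond_center.
  + by move=> x /(far _ _ ki) [[]].
- move=> T A Ainv v hA hv X avoidS hitH.
  have XT p : Te (Ainv (X p)).
    by apply: contrapT => nT; apply: (avoidS p); left; left.
  apply/eqP; rewrite eqn_leq; apply/andP; split.
    apply: (@pe_gamma_le2 R T A Ainv hA r i v hr hv n X XT (2 * s) w) => //.
    + by rewrite /w; lra.
    + move=> k ki; have [p hp] := hitH (k, false); exists p.
      by move: hp; rewrite /H /= /other (negbTE ki) => /(far _ _ ki) [].
    + move=> q; rewrite -/s (_ : 2 * s / 2 + w - s = w); last by field.
      apply: contrapT => /forall2NP h; apply: (avoidS q); right.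
      have lt k : k != i -> bary (Ainv (X q)) k < r * w.
        by move=> ki; have [|/negP] := h k => //; rewrite -ltNge.
      move/TeP: (XT q) => x0; have x1 := bary_cyc (Ainv (X q)) i.
      have l1 := lt _ (I3_neq1 i); have l2 := lt _ (I3_neq2 i).
      have := x0 (i + 1); have := x0 (i + 2) => g2 g1.
      move=> j; rewrite ler_norml bary_ye; case: (I3_cyc i j) => ->; rewrite I3_eqs /=;
        by apply/andP; split; lra.
  apply: (@pe_gamma_ge2 R T A Ainv hA r i v hr hv n X XT u u0).
    by move=> p; rewrite -/s -/M => hp; apply: (avoidS p); left; right.
  move=> k ki; have [p hp] := hitH (k, true); exists p => j jk.
  move: hp; rewrite /H /= /other (negbTE ki) => /(hex_near_center u12)[_ _ /(_ j jk) /andP[b1 b2]].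
  by apply/andP; split; lra.
Qed.

End Schemes.

(** * Favourable configurations in all triangles simultaneously *)

Section SchemeProbability.
Context {R : realType}.
Variables (r : R) (i : 'I_3) (D : set (R * R)) (Q : nat -> Prop).
Hypothesis hQ : scheme r i D Q.
Variables (J : nat) (T : 'I_J -> set (R * R)) (A Ainv : 'I_J -> R * R -> R * R).
Variables (v : 'I_J -> R * R -> 'I_3).
Hypothesis J_gt0 : (0 < J)%N.
Hypothesis hA : forall j, affine_chart (T j) (A j) (Ainv j).
Hypothesis hv : forall j, vertex_rule (A j \o ye) (A j (special_point r i)) (v j).
Variables (N : nat -> 'I_J -> nat).
Hypothesis hN : forall j, (fun n => N n j) @ \oo --> \oo.
Context d (Omega : measurableType d) (P : probability Omega R).
Variable X : forall n, {j & 'I_(N n j)} -> {RV P >-> (R * R)%type}.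
Arguments X : clear implicits.
Hypothesis hX : forall n, sample_under Ainv D (X n).

Lemma scheme_probability : exists2 c : R, 0 < c & \forall n \near \oo,
  exists F, [/\ measurable F, (c%:E <= P F)%E & forall w, F w ->
    forall j, Q (pe_gamma (A j \o ye) (v j) r
      (fun p : 'I_(N n j) => X n (Tagged (fun j => 'I_(N n j)) p) w))].
Proof.
pose H := ('I_J * ('I_3 * bool))%type.
have H_gt0 : (0 < #|{: H}|)%N.
  by apply/card_gt0P; exists (Ordinal J_gt0, (0, true)).
(* The expected number of hits that [probability_hit_avoid] asks for, counting the targets of all
   triangles. *)
have a0 : 0 < 2 * #|{: H}|%:R :> R by rewrite mulr_gt0 // ltr0n.
have [b [n0 big]] := hQ a0.
exists (expR (- (2 * (J%:R * b))) / 2); first by rewrite divr_gt0 // expR_gt0.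
(* The last condition makes each avoided set have probability at most [1 / 2]. *)
have : \forall n \near \oo, forall j,
    [/\ (n0 <= N n j)%N, (0 < N n j)%N & 2 * b <= (N n j)%:R].
  apply: filter_forall => j; have hj := @hN j.
  have h1 := hj _ (nbhs_infty_ge n0); have h2 := hj _ (nbhs_infty_ge 1).
  have h3 := hj _ (nbhs_infty_ger (2 * b)).
  by near=> n; split; near: n.
apply: filterS => n Nn.
have /choice[S /choice[G SG]] : forall j, exists S G,
    [/\ measurable S /\ (forall h, measurable (G h)),
    forall h, S `&` G h = set0, law D S <= b / (N n j)%:R,
    forall h, 2 * #|{: H}|%:R / (N n j)%:R <= law D (G h)
    & forces r i D S G (N n j) Q].
  by move=> j; have [nj1 nj2 _] := Nn j; exact: big.
pose I := {j & 'I_(N n j)}.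
pose S' (k : I) := Ainv (tag k) @^-1` S (tag k).
(* A target of one triangle is empty for the points of the others, so the whole sample is handled as
   one independent family. *)
pose G' (h : H) (k : I) :=
  if tag k == h.1 then Ainv (tag k) @^-1` G (tag k) h.2 else set0.
have mpre j E : measurable E -> measurable (Ainv j @^-1` E).
  by move=> mE; rewrite -[X in measurable X]setTI; exact: (chart_inv_measurable (hA j)).
have mS' k : measurable (S' k) by apply: mpre; have [[]] := SG (tag k).
have mG' h k : measurable (G' h k).
  by rewrite /G'; case: ifP => // _; apply: mpre; have [[]] := SG (tag k).
have SG' h k : S' k `&` G' h k = set0.
  rewrite /G'; case: ifP => _; last by rewrite setI0.
  by have [_ dis _ _ _] := SG (tag k); rewrite /S' -preimage_setI dis preimage_set0.
have prob_in_law (k : I) E : measurable E -> prob_in (X n) k (Ainv (tag k) @^-1` E) = law D E.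
  by move=> mE; have [_ /(_ k _ mE)] := hX n; rewrite /prob_in -comp_preimage => ->.
have sumI (F : 'I_J -> R) : \sum_(k : I) F (tag k) = \sum_j F j *+ N n j.
  rewrite -(@sig_big_dep R 0 _ 'I_J (fun j => 'I_(N n j)) xpredT (fun _ => xpredT) (fun j _ => F j)).
  by apply: eq_bigr => j _; rewrite sumr_const card_ord.
exists (hit_avoid (X n) S' G'); split.
- exact: measurable_hit_avoid.
- have [indep _] := hX n; apply: (probability_hit_avoid indep) => //.
  + move=> k; rewrite prob_in_law; last by have [[]] := SG (tag k).
    have [_ _ le _ _] := SG (tag k); apply: le_trans le _.
    have [_ N0 Nb] := Nn (tag k); rewrite ler_pdivrMr ?ltr0n //; lra.
  + apply: le_trans (_ : \sum_(k : I) b / (N n (tag k))%:R <= _).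
      apply: ler_sum => k _; rewrite prob_in_law; last by have [[]] := SG (tag k).
      by have [] := SG (tag k).
    rewrite (sumI (fun j => b / (N n j)%:R)) le_eqVlt; apply/orP; left; apply/eqP.
    rewrite (eq_bigr (fun=> b)); first by rewrite sumr_const card_ord mulr_natl.
    by move=> j _; have [_ N0 _] := Nn j; rewrite -[LHS]mulr_natr divfK // pnatr_eq0 -lt0n.
  + move=> [j h]; set a := 2 * _.
    pose f (k : 'I_J) := if k == j then a / (N n k)%:R else 0.
    apply: le_trans (_ : \sum_(k : I) f (tag k) <= _).
      rewrite sumI (bigD1 j) //= big1 ?addr0; last first.
        by move=> k kj; rewrite /f (negbTE kj) mul0rn.
      have [_ N0 _] := Nn j.
      by rewrite /f eqxx -[leRHS]mulr_natr divfK // pnatr_eq0 -lt0n.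
    apply: ler_sum => k _; rewrite /f /G' /=; case: ifP => [_|_]; last exact: prob_in_ge0.
    rewrite prob_in_law; last by have [[]] := SG (tag k).
    by have [] := SG (tag k).
- move=> w [avoidS hitG] j; have [_ _ _ _ force] := SG j.
  apply: (force _ _ _ _ (hA j) (hv j)).
    by move=> p; have := avoidS (Tagged (fun j => 'I_(N n j)) p).
  move=> h; have [[j' p]] := hitG (j, h); rewrite /G' /=.
  by case: eqP => // jj' Gp; subst j'; exists p.
Unshelve. all: by end_near.
Qed.

End SchemeProbability.

(** * Limiting values and the test *)

Section Supports.
Context {R : realType}.
Implicit Types (eps : R) (x : R * R).

Lemma area_wide_gt0 (D : set (R * R)) (eta : R) : measurable D -> 0 < eta ->
  (forall x k, Te x -> 1 - bary x k <= eta -> D x) -> (0 < area D)%E.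
Proof.
move=> mD e0 wide; pose u := Num.min (1 / 2) (eta / 2).
have u0 : 0 < u by rewrite lt_min; apply/andP; split; lra.
have : u <= u by []; rewrite {2}/u le_min => /andP[u1 u2].
apply: (@area_gt0 _ _ _ (u / 4) mD _ (sum_near_center 0 u)); first by rewrite divr_gt0.
move=> x /hex_near_center[|xT x0 _]; first by rewrite u0 u1.
by apply: (wide x 0 xT); lra.
Qed.

Lemma area_Te_gt0 : (0 < area (@Te R))%E.
Proof. by apply: (area_wide_gt0 measurable_Te ltr01). Qed.

(** The upper bound [2 / 3] says that the centroid, with coordinates [1 / 3], stays in the
    segregation support. *)
Lemma eps_bary eps : 0 < eps < Num.sqrt 3 / 3 -> 0 < 2 * eps / Num.sqrt 3 < 2 / 3.
Proof.
move=> /andP[e0 e3]; have q0 := @sqrt3_gt0 R.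
by rewrite divr_gt0 ?mulr_gt0 //= ltr_pdivrMr //; lra.
Qed.

Lemma segregation_bary eps x : segregation_support eps x <->
  Te x /\ forall j, 2 * eps / Num.sqrt 3 < 1 - bary x j.
Proof.
split=> [[xT nc]|[xT xj]].
  split=> // j; rewrite ltNge; apply/negP => le.
  by apply: nc; apply/corners_bary; split=> //; exists j.
by split=> // /corners_bary[_ [j]]; rewrite leNgt xj.
Qed.

Lemma measurable_segregation eps : measurable (@segregation_support R eps).
Proof.
by apply: measurableD; [exact: measurable_Te|exact: measurable_corners].
Qed.

Lemma area_segregation_gt0 eps : 0 < eps < Num.sqrt 3 / 3 ->
  (0 < area (segregation_support eps))%E.
Proof.
move=> /eps_bary; set delta := 2 * eps / _ => /andP[d0 d23].
apply: (@area_gt0 _ _ (fun=> 3^-1) ((2 / 3 - delta) / 2)).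
- exact: measurable_segregation.
- by lra.
- exact: sum_third.
- move=> x hx; have xb j : - ((2 / 3 - delta) / 2) <= bary x j - 3^-1 <= (2 / 3 - delta) / 2.
    by have := hx j; rewrite ler_norml.
  apply/segregation_bary; rewrite -/delta; split=> [|j].
    by apply/TeP => j; have /andP[] := xb j; lra.
  by have /andP[] := xb j; lra.
Qed.

Lemma association_wide eps x k : Te x ->
  1 - bary x k <= 2 / 3 - 2 * eps / Num.sqrt 3 -> association_support eps x.
Proof.
move=> xT xk; apply/corners_bary; split=> //; exists k.
rewrite (_ : 2 * (Num.sqrt 3 / 3 - eps) / Num.sqrt 3 = 2 / 3 - 2 * eps / Num.sqrt 3) //.
by field; exact: sqrt3_neq0.
Qed.

End Supports.

Section Probabilities.
Context {R : realType} d (Omega : measurableType d) (P : probability Omega R).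

Lemma probability_disjoint (F G : set Omega) (c : R) : measurable F -> measurable G ->
  (c%:E <= P F)%E -> (forall w, F w -> ~ G w) -> (P G <= (1 - c)%:E)%E.
Proof.
move=> mF mG cF FG; apply: le_trans (_ : P (~` F) <= _)%E.
  apply: le_measure; rewrite ?inE //; first exact: measurableC.
  by move=> w Gw Fw; exact: FG Gw.
by rewrite probability_setC // EFinB leeB.
Qed.

Lemma cvg_prob_subset (F G : nat -> set Omega) : (forall n, measurable (F n)) ->
  (forall n, measurable (G n)) -> (forall n, F n `<=` G n) ->
  (fun n => P (F n)) @ \oo --> 1%E -> (fun n => P (G n)) @ \oo --> 1%E.
Proof.
move=> mF mG FG F1; apply: (squeeze_cvge _ F1); last exact: cvg_cst.
apply: nearW => n; rewrite probability_le1 // andbT.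
by apply: le_measure; rewrite ?inE.
Qed.

Lemma measurable_close (G : Omega -> R) (g e : R) :
  measurable_fun setT G -> measurable [set w | `|G w - g| < e].
Proof.
move=> mG; rewrite (_ : [set w | _] = ~` [set w | e <= `|G w - g|]).
  apply: measurableC; apply: measurable_set_le => //.
  apply: measurableT_comp; first exact: normr_measurable.
  exact: measurable_funB.
by apply/seteqP; split => w /=; rewrite ltNge => /negP.
Qed.

(** Such events would keep the probability of being within [e] of [g] at most [1 - c], while it
    tends to 1. This locates [g] without knowing the law of [G]. *)
Lemma cvg_in_probability_close (G : nat -> Omega -> R) (g c e : R) :
  (forall n, measurable_fun setT (G n)) -> cvg_in_probability P G g -> 0 < c -> 0 < e ->
  ~ \forall n \near \oo, exists F, [/\ measurable F, (c%:E <= P F)%E &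
     forall w, F w -> e <= `|G n w - g|].
Proof.
move=> mG Gg c0 e0 FG.
have : (1%:E <= (1 - c)%:E :> \bar R)%E.
  apply: (cvge_to_le (Gg e e0)); apply: filterS FG => n [F [mF cF Fe]].
  apply: (probability_disjoint mF _ cF); first exact: measurable_close.
  by move=> w /Fe /=; rewrite leNgt => /negP.
by rewrite lee_fin; lra.
Qed.

End Probabilities.

(** * The test statistic and the critical value *)

Section Test.
Context {R : realType}.
Implicit Types (J : nat) (p g z : R).

Lemma null_sd_gt0 p : 0 < p < 1 -> 0 < null_sd p.
Proof. by move=> /andP[p0 p1]; rewrite sqrtr_gt0 mulr_gt0 // subr_gt0. Qed.

Lemma test_statB J p g g' :
  test_stat J p g - test_stat J p g' = Num.sqrt J%:R / null_sd p * (g - g').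
Proof. by rewrite /test_stat /null_mean; ring. Qed.

Lemma Jstar_sqr J p a g : 0 < p < 1 -> g != null_mean p ->
  Jstar p a g <= J%:Z -> quantile a ^+ 2 <= test_stat J p g ^+ 2.
Proof.
move=> p01 gm; have sd0 := null_sd_gt0 p01.
rewrite /Jstar ceil_le_int => le.
rewrite /test_stat expr_div_n exprMn sqr_sqrtr // ler_pdivlMr ?exprn_gt0 //.
have gm0 : 0 < (g - null_mean p) ^+ 2 by rewrite exprn_even_gt0 //= subr_eq0.
move: le; rewrite expr_div_n exprMn ler_pdivrMr //.
by rewrite -pmulrn => ?; lra.
Qed.

(** Both signs of [y] are covered: [y ^+ 2 <= x ^+ 2] with [x < 0] places [y] in [[x, - x]]. *)
Lemma lt_of_sqr_le (x y : R) : x < 0 -> y ^+ 2 <= x ^+ 2 -> x != y -> x < y.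
Proof.
move=> x0 yx xy; rewrite ltNge le_eqVlt eq_sym (negbTE xy) /=; apply/negP => ltyx.
have : 0 < (x - y) * (- x - y) by rewrite mulr_gt0 //; lra.
lra.
Qed.

Lemma test_stat_lt J p a g : (0 < J)%N -> 0 < p < 1 -> g < null_mean p ->
  Jstar p a g <= J%:Z -> test_stat J p g != quantile a ->
  test_stat J p g < quantile a.
Proof.
move=> J0 p01 gm Jle; apply: lt_of_sqr_le; last first.
  by apply: Jstar_sqr => //; rewrite lt_eqF.
rewrite /test_stat -mulrA pmulr_rlt0 ?sqrtr_gt0 ?ltr0n //.
by rewrite pmulr_llt0 ?invr_gt0 ?null_sd_gt0 // subr_lt0.
Qed.

Lemma test_stat_gt J p a g : (0 < J)%N -> 0 < p < 1 -> null_mean p < g ->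
  Jstar p a g <= J%:Z -> test_stat J p g != quantile a ->
  quantile a < test_stat J p g.
Proof.
move=> J0 p01 gm Jle; rewrite -ltrN2 -(inj_eq oppr_inj); apply: lt_of_sqr_le; last first.
  by rewrite !sqrrN; apply: Jstar_sqr => //; rewrite gt_eqF.
rewrite oppr_lt0 /test_stat -mulrA pmulr_rgt0 ?sqrtr_gt0 ?ltr0n //.
by rewrite pmulr_lgt0 ?invr_gt0 ?null_sd_gt0 // subr_gt0.
Qed.

Context d (Omega : measurableType d) (P : probability Omega R).
Variables (J : nat) (p g z : R) (G : nat -> Omega -> R).
Hypotheses (J0 : (0 < J)%N) (p01 : 0 < p < 1).
Hypothesis mG : forall n, measurable_fun setT (G n).
Hypothesis Gg : cvg_in_probability P G g.

Lemma measurable_test_stat n : measurable_fun setT (fun w => test_stat J p (G n w)).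
Proof.
apply: measurable_funM => //; apply: measurable_funM => //.
by apply: measurable_funB.
Qed.

Let slope_gt0 : 0 < Num.sqrt J%:R / null_sd p.
Proof. by rewrite divr_gt0 ?null_sd_gt0 // sqrtr_gt0 ltr0n. Qed.

Lemma measurable_lt_set (f h : Omega -> R) : measurable_fun setT f ->
  measurable_fun setT h -> measurable [set w | f w < h w].
Proof.
move=> mf mh; rewrite (_ : [set w | _] = ~` [set w | h w <= f w]).
  by apply: measurableC; exact: measurable_set_le.
by apply/seteqP; split => w /=; rewrite ltNge => /negP.
Qed.

Lemma test_rejects_lt : test_stat J p g < z ->
  (fun n => P [set w | test_stat J p (G n w) < z]) @ \oo --> 1%E.
Proof.
(* The statistic is affine in the mean, so the gap to the critical value divided by the slope is the
   tolerated error. *)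
move=> gz; pose e := (z - test_stat J p g) / (Num.sqrt J%:R / null_sd p).
have e0 : 0 < e by rewrite divr_gt0 // subr_gt0.
apply: cvg_prob_subset (Gg e0) => [n|n|n w /=].
- exact: measurable_close.
- by apply: measurable_lt_set => //; exact: measurable_test_stat.
- rewrite ltr_norml => /andP[_]; rewrite /e ltr_pdivlMr // mulrC -test_statB; lra.
Qed.

Lemma test_rejects_gt : z < test_stat J p g ->
  (fun n => P [set w | test_stat J p (G n w) > z]) @ \oo --> 1%E.
Proof.
move=> gz; pose e := (test_stat J p g - z) / (Num.sqrt J%:R / null_sd p).
have e0 : 0 < e by rewrite divr_gt0 // subr_gt0.
apply: cvg_prob_subset (Gg e0) => [n|n|n w /=].
- exact: measurable_close.
- by apply: measurable_lt_set => //; exact: measurable_test_stat.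
- rewrite ltr_norml => /andP[+ _]; rewrite ltrNl opprB /e ltr_pdivlMr // mulrC -test_statB; lra.
Qed.

End Test.

Section GammaMean.
Context {R : realType}.
Variables (J : nat) (T : 'I_J -> set (R * R)) (A Ainv : 'I_J -> R * R -> R * R).
Variables (r : R) (M : R * R) (v : 'I_J -> R * R -> 'I_3).
Hypothesis hA : forall j, affine_chart (T j) (A j) (Ainv j).
Hypothesis hv : forall j, vertex_rule (A j \o ye) (A j M) (v j).
Context d (Omega : measurableType d).

Lemma measurable_mean_gamma (N : 'I_J -> nat)
    (X : {j & 'I_(N j)} -> Omega -> R * R) :
  (forall k, measurable_fun setT (X k)) ->
  measurable_fun setT (fun w => mean_gamma A v r (fun k => X k w)).
Proof.
move=> mX; apply: measurable_funM; last exact: measurable_cst.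
apply: measurable_sum => j _ E mE; rewrite setTI.
exact: (@measurable_pe_gamma R _ _ _ (hA j) r _ _ (hv j) _ _ (N j)
  (fun p => X (Tagged (fun j => 'I_(N j)) p)) (fun g => E g%:R) (fun p => mX _)).
Qed.

Lemma mean_gamma_bound (N : 'I_J -> nat) (X : {j & 'I_(N j)} -> R * R) (m : nat) :
  (0 < J)%N ->
  let g j := pe_gamma (A j \o ye) (v j) r (fun p : 'I_(N j) => X (Tagged (fun j => 'I_(N j)) p)) in
  ((forall j, g j <= m)%N -> mean_gamma A v r X <= m%:R) /\
  ((forall j, m <= g j)%N -> m%:R <= mean_gamma A v r X).
Proof.
move=> J0 g; have J0' : 0 < J%:R :> R by rewrite ltr0n.
have E : m%:R = (\sum_(j < J) m%:R) / J%:R :> R.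
  by rewrite sumr_const card_ord -[X in X / _]mulr_natr mulfK // gt_eqF.
rewrite E /mean_gamma; split=> h; rewrite ler_pM2r ?invr_gt0 //;
  by apply: ler_sum => j _; rewrite ler_nat; exact: h.
Qed.

End GammaMean.

Section NullCase.
Context {R : realType} d (Omega : measurableType d) (P : probability Omega R).

(** Presents the null sample as the case of one triangle, [Te] with the identity chart, so that
    [scheme_probability] applies. *)
Lemma sample_under_null (n : nat) (U : 'I_n -> {RV P >-> (R * R)%type}) (D : set (R * R)) :
  mutually_independent U -> (forall k, uniform_law P (U k) D) ->
  sample_under (fun _ : 'I_1 => id) D
    (fun k : {j : 'I_1 & 'I_n} => U (tagged k)).
Proof.
move=> indep law; split=> [E mE|[j k]]; last exact: law.
pose T k : {j : 'I_1 & 'I_n} := Tagged (fun _ => 'I_n) (i := ord0) k.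
have -> : \bigcap_(k in setT) (U (tagged k) @^-1` E k)
    = \bigcap_(k in setT) (U k @^-1` E (T k)).
  apply/seteqP; split => w /= h k _; first exact: (h (T k)).
  by case: k => j k /=; rewrite (ord1 j); exact: h.
rewrite indep => [|k]; last exact: mE.
apply/esym; transitivity (\prod_(j < 1) \prod_(k < n)
    P (U k @^-1` E (Tagged (fun _ => 'I_n) (i := j) k)))%E.
  by rewrite sig_big_dep; apply: eq_bigr => -[j k] _.
by rewrite big_ord1.
Qed.

Variables (r : R) (i : 'I_3) (Q : nat -> Prop) (v0 : R * R -> 'I_3).
Hypothesis hQ : scheme r i Te Q.
Hypothesis hv0 : vertex_rule ye (special_point r i) v0.
Variable U : forall n : nat, 'I_n -> {RV P >-> (R * R)%type}.
Arguments U : clear implicits.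
Hypothesis hU : forall n, mutually_independent (U n) /\
  forall k, uniform_law P (U n k) Te.

Lemma null_probability : exists2 c : R, 0 < c & \forall n \near \oo,
  exists F, [/\ measurable F, (c%:E <= P F)%E &
    forall w, F w -> Q (pe_gamma ye v0 r (fun k => U n k w))].
Proof.
have hX n := sample_under_null (hU n).1 (hU n).2.
have hN (j : 'I_1) : (fun n : nat => n) @ \oo --> \oo by exact: cvg_id.
have [c c0 FP] := scheme_probability hQ (ltn0Sn 0) (fun _ => chart_id)
  (fun _ => hv0) (N := fun n _ => n) hN hX.
exists c => //; apply: filterS FP => n [F [mF cF FQ]].
by exists F; split => // w /FQ /(_ ord0).
Qed.

Lemma measurable_null_gamma n (B : nat -> Prop) :
  measurable [set w | B (pe_gamma ye v0 r (fun k => U n k w))].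
Proof.
exact: (@measurable_pe_gamma R _ _ _ chart_id r _ _ hv0 _ _ n (U n) B).
Qed.

End NullCase.

(** With probability bounded below [gamma = 2], which gives [p > 0]; with probability bounded below
    [gamma >= 3], which gives [p < 1]. *)
Lemma null_limit_gt0_lt1 (R : realType) (r : R) (i : 'I_3) d (Omega : measurableType d)
    (P : probability Omega R) (U : forall n : nat, 'I_n -> {RV P >-> (R * R)%type})
    (v0 : R * R -> 'I_3) (p : R) : 1 < r <= 3 / 2 ->
  (forall n, mutually_independent (U n) /\ forall k, uniform_law P (U n k) Te) ->
  vertex_rule ye (special_point r i) v0 ->
  (fun n => P [set w | pe_gamma ye v0 r (fun k => U n k w) = 2%N]) @ \oo --> p%:E ->
  0 < p < 1.
Proof.
move=> hr hU hv0 hp; apply/andP; split.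
- have [c c0 FP] := null_probability (scheme_eq2 i hr area_Te_gt0) hv0 hU.
  apply: lt_le_trans c0 _; rewrite -lee_fin; apply: (cvge_to_ge hp).
  apply: filterS FP => n [F [mF cF FQ]]; apply: le_trans cF _.
  apply: le_measure; rewrite ?inE //.
  exact: (@measurable_null_gamma R _ _ P r i v0 hv0 U n (fun g => g = 2%N)).
- have wide (x : R * R) k : Te x -> 1 - bary x k <= 1 -> Te x by [].
  have [c c0 FP] := null_probability (scheme_ge3 i hr measurable_Te
    (@subset_refl _ _) area_Te_gt0 ltr01 wide) hv0 hU.
  apply: (@le_lt_trans _ _ (1 - c)); last by lra.
  rewrite -lee_fin; apply: (cvge_to_le hp).
  apply: filterS FP => n [F [mF cF FQ]].
  apply: (probability_disjoint mF _ cF).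
    exact: (@measurable_null_gamma R _ _ P r i v0 hv0 U n (fun g => g = 2%N)).
  by move=> w /FQ /= + g2; rewrite g2.
Qed.

Theorem theorem4p5 (R : realType) (r : R) (hr : 1 < r <= 3 / 2)
  (M : R * R) (hM : exists i, M = special_point r i)
  (alpha : R) (halpha : 0 < alpha < 1)
  (* p is the null limit p_r of P (gamma_n = 2) *)
  (d0 : measure_display) (Omega0 : measurableType d0)
  (P0 : probability Omega0 R)
  (U : forall n : nat, 'I_n -> {RV P0 >-> (R * R)%type})
  (hU : forall n, mutually_independent (U n) /\
          forall i, uniform_law P0 (U n i) Te)
  (v0 : R * R -> 'I_3) (hv0 : vertex_rule ye M v0)
  (p : R)
  (hp : (fun n => P0 [set w | pe_gamma ye v0 r (fun i => U n i w) = 2%N])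
          @ \oo --> p%:E)
  (m : nat) (hm : (3 < m)%N) (Y : 'I_m -> R * R) (hY : injective Y)
  (hY3 : no_three_collinear Y) (hY4 : no_four_cocircular Y)
  (A Ainv : 'I_(num_triangles Y) -> R * R -> R * R)
  (hA : forall j, affine_chart (delaunay_triangle j) (A j) (Ainv j))
  (v : 'I_(num_triangles Y) -> R * R -> 'I_3)
  (hv : forall j, vertex_rule (A j \o ye) (A j M) (v j))
  (N : nat -> 'I_(num_triangles Y) -> nat)
  (hNsum : forall n, (\sum_j N n j)%N = n)
  (hNoo : forall j, (fun n => N n j) @ \oo --> \oo)
  (d : measure_display) (Omega : measurableType d) (P : probability Omega R)
  (X : forall n, {j & 'I_(N n j)} -> {RV P >-> (R * R)%type}) :
  let J := num_triangles Y in
  let Gbar n w := mean_gamma A v r (fun k => X n k w) in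
  let S n w := test_stat J p (Gbar n w) in
  (forall (eps g : R), 0 < eps < Num.sqrt 3 / 3 ->
     (forall n, sample_under Ainv (segregation_support eps) (X n)) ->
     cvg_in_probability P Gbar g ->
     Jstar p alpha g <= J%:Z ->
     (* At a tie the statistic equals the critical value with probability tending
        to one, and the strict test does not reject. *)
     test_stat J p g != quantile alpha ->
     (fun n => P [set w | S n w < quantile alpha]) @ \oo --> 1%E)
  /\
  (forall (eps g : R), 0 < eps < Num.sqrt 3 / 3 ->
     (forall n, sample_under Ainv (association_support eps) (X n)) ->
     cvg_in_probability P Gbar g ->
     Jstar p (1 - alpha) g <= J%:Z ->
     test_stat J p g != quantile (1 - alpha) ->
     (fun n => P [set w | S n w > quantile (1 - alpha)]) @ \oo --> 1%E).
Proof.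
case: hM => i ME; rewrite {M}ME in hv0 hv *.
move=> J Gbar S.
have p01 := null_limit_gt0_lt1 hr hU hv0 hp.
(* Without triangles the counts could not sum to 1. *)
have J0 : (0 < J)%N.
  rewrite lt0n; apply/negP => /eqP J0; have := hNsum 1%N.
  by rewrite big1 // => j; exfalso; move: (ltn_ord j); rewrite ltnNge -/J [X in (X <= _)%N]J0.
have mG n : measurable_fun setT (Gbar n).
  apply: (@measurable_mean_gamma R J _ A Ainv r _ v hA hv _ Omega (N n) (fun k => X n k)).
  by move=> k; exact: measurable_funP.
split=> eps g heps hX Gg Jle ne.
- have [c c0 FP] := scheme_probability (scheme_le2 i hr (measurable_segregation eps)
    (fun x h => h.1) (area_segregation_gt0 heps) (eps_bary heps)
    (segregation_bary eps)) J0 hA hv hNoo hX.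
  (* Otherwise the mean would stay at distance at least [g - 2] from its limit with non-vanishing
     probability. *)
  have g2 : g <= 2.
    rewrite leNgt; apply/negP => g2; have e0 : 0 < g - 2 by rewrite subr_gt0.
    apply: (cvg_in_probability_close mG Gg c0 e0).
    apply: filterS FP => n [F [mF cF FQ]]; exists F; split => // w /FQ Fw.
    have [le _] := mean_gamma_bound A r v (fun k => X n k w) 2 J0.
    rewrite distrC ger0_norm ?subr_ge0 ?lerD2l ?lerN2.
      exact: le.
    by apply: le_trans (ltW g2); exact: le.
  apply: (test_rejects_lt J0 p01 mG Gg); apply: test_stat_lt => //.
  by apply: le_lt_trans g2 _; rewrite /null_mean; case/andP: p01; lra.
(* The association support contains the corners of width [eta = 2 / 3 - 2 * eps / Num.sqrt 3], which
   is positive. *)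
- have /andP[_ eta0] := eps_bary heps; rewrite -subr_gt0 in eta0.
  have mD : measurable (association_support eps) by exact: measurable_corners.
  have DT : association_support eps `<=` Te by move=> x /corners_bary[].
  have wide := @association_wide R eps.
  have [c c0 FP] := scheme_probability (scheme_ge3 i hr mD DT
    (area_wide_gt0 mD eta0 wide) eta0 wide) J0 hA hv hNoo hX.
  have g3 : 3 <= g.
    rewrite leNgt; apply/negP => g3; have e0 : 0 < 3 - g by rewrite subr_gt0.
    apply: (cvg_in_probability_close mG Gg c0 e0).
    apply: filterS FP => n [F [mF cF FQ]]; exists F; split => // w /FQ Fw.
    have [_ le] := mean_gamma_bound A r v (fun k => X n k w) 3 J0.
    rewrite ger0_norm ?subr_ge0 ?lerD2r.
      exact: le.
    by apply: le_trans (ltW g3) _; exact: le.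
  apply: (test_rejects_gt J0 p01 mG Gg); apply: test_stat_gt => //.
  by apply: lt_le_trans g3; rewrite /null_mean; case/andP: p01; lra.
Qed.
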